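(* Let $S$ be a smooth surface and let $\phi:S\to Q$ be a totally isotropic immersion such that $\phi_+:S\to Q$ and $\phi_-:S\to Q$ are also immersions. Then the operations $(\ )_+$ and $(\ )_-$ on $\{\phi,\phi_+,\phi_-\}$ are the two generators of an action of $\mathbb{Z}/3\mathbb{Z}$ (that is, each of them maps this set to itself, they are inverse to each other, and the cube of each is the identity).
   Context: Zorn matrices. Let $\mathcal{Z}$ be the real algebra of matrices $\begin{pmatrix} a & x \\ y & b \end{pmatrix}$, $a,b\in\mathbb{R}$, $x,y\in\mathbb{R}^3$, with product $$\begin{pmatrix} a & x \\ y & b \end{pmatrix}\begin{pmatrix} a' & x' \\ y' & b' \end{pmatrix}=\begin{pmatrix} aa'+x\cdot y' & ax'+b'x-y\times y' \\ a'y+by'+x\times x' & x'\cdot y+bb' \end{pmatrix}$$ and multiplicative norm $N=ab-x\cdot y$ of signature $(4,4)$; it is a split octonion algebra. $L_Z,R_Z$ denote left and right multiplication by $Z$. For $Z\neq0$ with $N(Z)=0$, $\ker L_Z$ and $\ker R_Z$ are maximal (4-dimensional) totally isotropic subspaces; each maximal totally isotropic subspace is of exactly one of these two forms, with $Z$ unique up to scalar, and each 3-dimensional totally isotropic subspace is contained in exactly one of each form. Quadric. $\mathbb{R}^{4,4}=\mathbb{R}^3\times\mathbb{R}\times\mathbb{R}^3\times\mathbb{R}$ carries $q(x,s,y,t)=x\cdot y+st$, and $Q=\{(x:s:y:t): x\cdot y+st=0\}\subset P(\mathbb{R}^{4,4})=\mathbb{R}P^7$. The linear isomorphism $\rho:\mathbb{R}^{4,4}\to\mathcal{Z}$,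 $\rho(x,s,y,t)=\begin{pmatrix} s & x \\ y & -t \end{pmatrix}$, satisfies $N\circ\rho=-q$ and identifies $Q$ with the quadric of isotropic lines of $\mathcal{Z}$. A smooth map $\phi:S\to Q$ is totally isotropic if for every local lift $\psi:S\to\mathbb{R}^{4,4}\setminus\{0\}$ and every $p$, the subspace $V_p=\mathbb{R}\psi(p)+\mathrm{im}\,d\psi(p)$ is totally isotropic; if $\phi$ is an immersion, $\dim V_p=3$. For a totally isotropic immersion $\phi:S\to Q$, the maps $\phi_\pm:S\to Q$ are defined by: $\phi_+(p)\in Q$ is the point such that $\rho(\phi_+(p))=\mathbb{R}Z_+$ with $\ker L_{Z_+}\supset\rho(V_p)$, and $\phi_-(p)\in Q$ is the point such that $\rho(\phi_-(p))=\mathbb{R}Z_-$ with $\ker R_{Z_-}\supset\rho(V_p)$. The maps $\phi_\pm$ are smooth and totally isotropic. The operations $(\ )_\pm$ are $\phi\mapsto\phi_\pm$, defined on totally isotropic immersions. *)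

(* Defs.v *)
From HB Require Import structures.
From mathcomp Require Import all_boot all_order all_algebra all_fingroup.
From mathcomp Require Import all_classical all_reals all_analysis.

Set Implicit Arguments.
Unset Strict Implicit.
Unset Printing Implicit Defensive.

Import Order.TTheory GRing.Theory Num.Theory.
Import numFieldNormedType.Exports.

Local Open Scope classical_set_scope.
Local Open Scope ring_scope.

(* f is C^k (resp. smooth) on U; only meaningful for U open, since 'd and 'D
   at a point depend on the values of f in a whole neighbourhood. *)
Fixpoint Ck (R : realType) (V W : normedModType R) (k : nat)
    (U : set V) (f : V -> W) : Prop :=
  match k with
  | 0 => forall x, U x -> {for x, continuous f}
  | k'.+1 => (forall x, U x -> differentiable f x) /\
             (forall v : V, Ck k' U (fun x => 'D_v f x))
  end.

Definition smooth_on (R : realType) (V W : normedModType R)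
    (U : set V) (f : V -> W) : Prop := forall k, Ck k U f.

(* A chart: a homeomorphism from the open set [cdom] onto an open subset of
   R^2, with inverse [cinv]; [cfun] and [cinv] are arbitrary outside of [cdom]
   and of its image. *)
Record chart (R : realType) (S : topologicalType) := Chart {
  cdom : set S ;
  cfun : S -> 'rV[R]_2 ;
  cinv : 'rV[R]_2 -> S ;
  cdom_open : open cdom ;
  cimg_open : open (cfun @` cdom) ;
  cfunK : forall p, cdom p -> cinv (cfun p) = p ;
  cfun_cont : forall p, cdom p -> {for p, continuous cfun} ;
  cinv_cont : forall p, cdom p -> {for cfun p, continuous cinv} }.

Record smooth_surface (R : realType) (S : topologicalType) := SmoothSurface {
  atlas : set (chart R S) ;
  surface_hausdorff : hausdorff_space S ;
  surface_second_countable : @second_countable S ;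
  atlas_cover : forall p, exists2 c, atlas c & cdom c p ;
  atlas_compatible : forall c c', atlas c -> atlas c' ->
    smooth_on (cfun c @` (cdom c `&` cdom c')) (cfun c' \o cinv c) }.

(* Smoothness of a vector-valued map on an open subset U of a surface. *)
Definition smooth_map_on (R : realType) (S : topologicalType)
    (A : smooth_surface R S) (W : normedModType R)
    (U : set S) (f : S -> W) : Prop :=
  forall c, atlas A c -> smooth_on (cfun c @` (cdom c `&` U)) (f \o cinv c).

Section VectorProducts.
Variable R : realType.
Implicit Types x y : 'rV[R]_3.

Definition dot x y : R := \sum_(i < 3) x 0 i * y 0 i.

(* Indices are added in Z/3. *)
Definition cross x y : 'rV[R]_3 :=
  \row_(i < 3) (x 0 (i + 1) * y 0 (i + 2) - x 0 (i + 2) * y 0 (i + 1)).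

End VectorProducts.

Section Zorn.
Variable R : realType.

(* The Zorn matrix with rows (a, x) and (y, b) is encoded as (a, x, y, b). *)
Definition zorn : Type := (R^o * 'rV[R]_3 * 'rV[R]_3 * R^o)%type.

Definition zmul (Z Z' : zorn) : zorn :=
  let: (a, x, y, b) := Z in
  let: (a', x', y', b') := Z' in
  (a * a' + dot x y', a *: x' + b' *: x - cross y y',
   a' *: y + b *: y' + cross x x', dot x' y + b * b').

Definition kerL (Z : zorn) : set zorn := [set W | zmul Z W = 0].
Definition kerR (Z : zorn) : set zorn := [set W | zmul W Z = 0].

(* R^{4,4}, with elements (x, s, y, t). *)
Definition R44 : Type := ('rV[R]_3 * R^o * 'rV[R]_3 * R^o)%type.

Definition qform (v : R44) : R :=
  let: (x, s, y, t) := v in dot x y + s * t.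

Definition rho (v : R44) : zorn :=
  let: (x, s, y, t) := v in (s, x, y, - t).

Definition totally_isotropic_set (V : set R44) : Prop :=
  forall v, V v -> qform v = 0.

End Zorn.

Section Projective.
Variable R : realType.

(* The projective space P(R^{4,4}); its points are lines. *)
Definition proj : Type := {l : {vspace R44 R} | \dim l == 1%N}.

Definition quadric : set proj :=
  [set z | totally_isotropic_set [set` (val z : {vspace R44 R})]].

Definition line (z : quadric) : {vspace R44 R} := val (val z).

(* The affine chart of P(R^{4,4}) attached to a linear form l: a line on which
   l is not zero is sent to its unique vector v such that l v = 1.  The
   standard charts are those of the 8 coordinate forms.  The target is kept as
   the affine hyperplane l = 1 of R^{4,4} instead of being identified with R^7,
   which affects neither smoothness nor the rank of differentials. *)
Definition affine_dom (l : {linear R44 R -> R^o}) : set proj :=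
  [set z | exists2 v, v \in (val z : {vspace R44 R}) & l v != 0].

Definition affine_coord (l : {linear R44 R -> R^o}) (z : proj) : R44 R :=
  (l (vpick (val z)))^-1 *: vpick (val z).

End Projective.

Arguments quadric : clear implicits.

Section TotallyIsotropicMaps.
Variables (R : realType) (S : topologicalType) (A : smooth_surface R S).
Implicit Types phi : S -> quadric R.

Definition in_coord (l : {linear R44 R -> R^o}) phi : S -> R44 R :=
  fun p => affine_coord l (val (phi p)).

(* Q is a submanifold of P(R^{4,4}), so smoothness and immersivity of maps to Q
   are those of the corresponding maps to P(R^{4,4}).  Continuity follows from
   the two clauses. *)
Definition smooth phi : Prop :=
  forall l : {linear R44 R -> R^o},
    let U := [set p | affine_dom l (val (phi p))] in
    open U /\ smooth_map_on A U (in_coord l phi).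

Definition immersion phi : Prop :=
  smooth phi /\
  forall (l : {linear R44 R -> R^o}) c p,
    atlas A c -> cdom c p -> affine_dom l (val (phi p)) ->
    injective ('d (in_coord l phi \o cinv c) (cfun c p)).

Definition local_lift phi (U : set S) (psi : S -> R44 R) : Prop :=
  [/\ open U, smooth_map_on A U psi &
      forall p, U p -> psi p != 0 /\ psi p \in line (phi p)].

(* V is the subspace V_p = R psi(p) + im dpsi(p) given by some local lift psi of
   phi around p, the differential being computed in some chart around p.  V_p
   depends neither on the lift nor on the chart. *)
Definition is_Vp phi (p : S) (V : set (R44 R)) : Prop :=
  exists U psi c,
    [/\ local_lift phi U psi, U p, atlas A c, cdom c p &
        V = [set v | exists (a : R) (w : 'rV[R]_2),
                v = a *: psi p + 'd (psi \o cinv c) (cfun c p) w]].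

Definition totally_isotropic phi : Prop :=
  smooth phi /\ forall p V, is_Vp phi p V -> totally_isotropic_set V.

Definition totally_isotropic_immersion phi : Prop :=
  totally_isotropic phi /\ immersion phi.

Definition plus_point phi (p : S) (z : quadric R) : Prop :=
  exists Z : zorn R,
    @rho R @` [set` line z] = [set a *: Z | a in [set: R]] /\
    (forall V, is_Vp phi p V -> @rho R @` V `<=` kerL Z).

Definition minus_point phi (p : S) (z : quadric R) : Prop :=
  exists Z : zorn R,
    @rho R @` [set` line z] = [set a *: Z | a in [set: R]] /\
    (forall V, is_Vp phi p V -> @rho R @` V `<=` kerR Z).

(* When phi is a totally isotropic immersion there is exactly one such point;
   phi p is only a junk value for the other maps. *)
Definition op_plus phi : S -> quadric R :=
  fun p => xget (phi p) [set z | plus_point phi p z].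

Definition op_minus phi : S -> quadric R :=
  fun p => xget (phi p) [set z | minus_point phi p z].

End TotallyIsotropicMaps.

(* Main.v *)
Require Import Defs.
From HB Require Import structures.
From mathcomp Require Import all_boot all_order all_algebra all_fingroup.
From mathcomp Require Import all_classical all_reals all_analysis.
From mathcomp Require Import ring lra.

(** Let z, w, m be local lifts of phi, phi_+, phi_- to the Zorn algebra, and let
    u, v denote partial derivatives.  By definition w z = w z_u = w z_v = 0, and
    differentiating w z = 0 gives w_u z = w_v z = 0: hence phi_+ is totally
    isotropic and (phi_+)_- = phi; likewise (phi_-)_+ = phi.  For
    (phi_+)_+ = phi_- one needs m w = 0, which is pointwise algebra, and
    m w_u = m w_v = 0.  From z m = 0 and w_u z = 0 it follows that m w_u is a
    multiple of the conjugate of z.  Differentiating w z_u = w z_v = 0 and using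
    z_uv = z_vu gives w_u z_v = w_v z_u, which forces that multiple to vanish
    (lemma [zmul_integrable]).  Finally m_u w = - m w_u = 0 gives
    (phi_-)_- = phi_+. *)

Set Implicit Arguments.
Unset Strict Implicit.
Unset Printing Implicit Defensive.

Import Order.TTheory GRing.Theory Num.Theory.
Import numFieldNormedType.Exports.

Local Open Scope classical_set_scope.
Local Open Scope ring_scope.

(** * Zorn algebra *)

Section ZornAlgebra.
Variable R : realType.
Implicit Types p q k z w m Z W : zorn R.

(** The relations w z = z m = m w = 0 are cyclic in (w, z, m), and this is the origin of the period
    three: once the derivatives satisfy them too, each operation merely rotates the triple. The
    product is not associative, so brackets are moved only through the polarised norm identity
    [zmul_clifford] and its mirror image [zmul_cliffordl]: orthogonal factors trade places at the
    cost of a sign and of conjugations. Existence and uniqueness of annihilating elements are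
    derived from this, with the help of vectors dual for [zdot]. In the analysis, vector identities
    are tested against the linear forms [zform q], which brings them down to scalar functions, where
    the mean value theorem applies. The same forms normalise the lifts: the condition [zform q = 1]
    fixes the scale and puts all derivatives of the lift in the kernel of [zform q]. Smoothness of
    phi_+ and phi_- comes with the assumption that they are immersions. *)

Definition zbar Z : zorn R := let: (a, x, y, b) := Z in (b, - x, - y, a).

(** The polarised norm: [zdot Z Z] is twice N(Z), so null elements are those with [zdot Z Z = 0]. *)
Definition zdot Z W : R :=
  let: (a, x, y, b) := Z in
  let: (a', x', y', b') := W in
  a * b' + a' * b - dot x y' - dot x' y.

Lemma dot3E (x y : 'rV[R]_3) :
  dot x y = x 0 0 * y 0 0 + x 0 1 * y 0 1 + x 0 (1 + 1) * y 0 (1 + 1).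
Proof.
rewrite /dot !big_ord_recr big_ord0 /= add0r.
congr (_ + _ + _); congr (x 0 _ * y 0 _); exact: val_inj.
Qed.

Lemma cross3E0 (x y : 'rV[R]_3) :
  cross x y 0 0 = x 0 1 * y 0 (1 + 1) - x 0 (1 + 1) * y 0 1.
Proof.
by rewrite !mxE; congr (x 0 _ * y 0 _ - x 0 _ * y 0 _); exact: val_inj.
Qed.

Lemma cross3E1 (x y : 'rV[R]_3) :
  cross x y 0 1 = x 0 (1 + 1) * y 0 0 - x 0 0 * y 0 (1 + 1).
Proof.
by rewrite !mxE; congr (x 0 _ * y 0 _ - x 0 _ * y 0 _); exact: val_inj.
Qed.

Lemma cross3E2 (x y : 'rV[R]_3) :
  cross x y 0 (1 + 1) = x 0 0 * y 0 1 - x 0 1 * y 0 0.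
Proof.
by rewrite !mxE; congr (x 0 _ * y 0 _ - x 0 _ * y 0 _); exact: val_inj.
Qed.

Definition cross3E := (cross3E0, cross3E1, cross3E2).

Lemma rV3P (x y : 'rV[R]_3) :
  x 0 0 = y 0 0 -> x 0 1 = y 0 1 -> x 0 (1 + 1) = y 0 (1 + 1) -> x = y.
Proof.
move=> h0 h1 h2; apply/rowP => -[[|[|[|//]]] i].
- by rewrite (_ : Ordinal i = 0) //; exact: val_inj.
- by rewrite (_ : Ordinal i = 1) //; exact: val_inj.
- by rewrite (_ : Ordinal i = 1 + 1) //; exact: val_inj.
Qed.

Lemma zorn_eq (a a' b b' : R^o) (x x' y y' : 'rV[R]_3) :
  a = a' -> x = x' -> y = y' -> b = b' -> (a, x, y, b) = (a', x', y', b').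
Proof. by move=> -> -> -> ->. Qed.

Ltac zcoord := rewrite /= ?(dot3E, cross3E, mxE) /GRing.scale /=.
Ltac zring :=
  repeat case=> [[[? ?] ?] ?];
  rewrite /zmul /zbar /zdot; try apply: zorn_eq; try apply: rV3P; zcoord; ring.

Lemma zbarK : involutive zbar.
Proof. by case=> [[[a x] y] b]; rewrite /zbar !opprK. Qed.

Lemma zbarM p q : zbar (zmul p q) = zmul (zbar q) (zbar p).
Proof. move: p q; zring. Qed.

Lemma zbarD p q : zbar (p + q) = zbar p + zbar q.
Proof. move: p q; zring. Qed.

Lemma zbarZ (a : R) p : zbar (a *: p) = a *: zbar p.
Proof. move: p; zring. Qed.

Lemma zmulDl p q k : zmul (p + q) k = zmul p k + zmul q k.
Proof. move: p q k; zring. Qed.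

Lemma zmulDr p q k : zmul p (q + k) = zmul p q + zmul p k.
Proof. move: p q k; zring. Qed.

Lemma zmulZl (a : R) p q : zmul (a *: p) q = a *: zmul p q.
Proof. move: p q; zring. Qed.

Lemma zmulZr (a : R) p q : zmul p (a *: q) = a *: zmul p q.
Proof. move: p q; zring. Qed.

Lemma zdotC p q : zdot p q = zdot q p.
Proof. move: p q; zring. Qed.

Lemma zdotDl p q k : zdot (p + q) k = zdot p k + zdot q k.
Proof. move: p q k; zring. Qed.

Lemma zdotZl (a : R) p q : zdot (a *: p) q = a * zdot p q.
Proof. move: p q; zring. Qed.

Lemma zdot_bar p q : zdot (zbar p) (zbar q) = zdot p q.
Proof. move: p q; zring. Qed.

Lemma zdotMl p q k : zdot (zmul p q) k = zdot p (zmul k (zbar q)).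
Proof. move: p q k; zring. Qed.

(** Polarisation in k of (p k) k^- = N(k) p, the substitute for associativity throughout. *)
Lemma zmul_clifford p k q :
  zmul (zmul p k) (zbar q) + zmul (zmul p q) (zbar k) = zdot k q *: p.
Proof. move: p k q; zring. Qed.

Lemma zmul0l q : zmul 0 q = 0.
Proof. by rewrite -(scale0r (0 : zorn R)) zmulZl !scale0r. Qed.

Lemma zmul0r p : zmul p 0 = 0.
Proof. by rewrite -(scale0r (0 : zorn R)) zmulZr !scale0r. Qed.

Lemma zbar0 : zbar 0 = 0 :> zorn R.
Proof. by rewrite -(scale0r (0 : zorn R)) zbarZ !scale0r. Qed.

Lemma zbar_eq0 p : zbar p = 0 -> p = 0.
Proof. by move=> h; rewrite -(zbarK p) h zbar0. Qed.

Lemma zmulNl p q : zmul (- p) q = - zmul p q.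
Proof. by rewrite -scaleN1r zmulZl scaleN1r. Qed.

Lemma zdotDr p q k : zdot p (q + k) = zdot p q + zdot p k.
Proof. by rewrite zdotC zdotDl !(zdotC p). Qed.

Lemma zdotZr (a : R) p q : zdot p (a *: q) = a * zdot p q.
Proof. by rewrite zdotC zdotZl zdotC. Qed.

Lemma zdot0l p : zdot 0 p = 0.
Proof. by rewrite -(scale0r (0 : zorn R)) zdotZl mul0r. Qed.

Lemma zmul_cliffordl p q k :
  zmul (zbar p) (zmul q k) + zmul (zbar q) (zmul p k) = zdot p q *: k.
Proof.
have := zmul_clifford (zbar k) (zbar q) (zbar p).
move/(congr1 (fun v => zbar v)).
rewrite zbarD zbarZ !zbarM !zbarK zdot_bar => ->.
by rewrite zdotC.
Qed.

Lemma zmul_swap p k q : zdot k q = 0 ->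
  zmul (zmul p k) (zbar q) = - zmul (zmul p q) (zbar k).
Proof.
move=> h; have /eqP := zmul_clifford p k q.
by rewrite h scale0r addr_eq0 => /eqP.
Qed.

Lemma zmul_swapV p k q : zdot k q = 0 ->
  zmul (zmul p (zbar k)) q = - zmul (zmul p (zbar q)) k.
Proof. by move=> h; rewrite -{1}(zbarK q) zmul_swap ?zdot_bar // zbarK. Qed.

Lemma zmul_swapl p q k : zdot p q = 0 ->
  zmul (zbar p) (zmul q k) = - zmul (zbar q) (zmul p k).
Proof.
move=> h; have /eqP := zmul_cliffordl p q k.
by rewrite h scale0r addr_eq0 => /eqP.
Qed.

Lemma zmul_swaplV p q k : zdot p q = 0 ->
  zmul p (zmul (zbar q) k) = - zmul q (zmul (zbar p) k).
Proof. by move=> h; rewrite -{1}(zbarK p) zmul_swapl ?zdot_bar // zbarK. Qed.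

Lemma zmul_null p k : zdot k k = 0 -> zmul (zmul p k) (zbar k) = 0.
Proof.
move=> /(zmul_swap p)/eqP; rewrite -addr_eq0 -mulr2n -scaler_nat.
by rewrite scaler_eq0 pnatr_eq0 /= => /eqP.
Qed.

Lemma zmul_nullV p k : zdot k k = 0 -> zmul (zmul p (zbar k)) k = 0.
Proof. by move=> h; rewrite -{2}(zbarK k) zmul_null ?zdot_bar. Qed.

Lemma zmul_nulll k p : zdot k k = 0 -> zmul (zbar k) (zmul k p) = 0.
Proof. by move=> h; apply: zbar_eq0; rewrite !zbarM zbarK zmul_nullV. Qed.

Lemma zmul1l p : zmul ((1, 0, 0, 1) : zorn R) p = p.
Proof. move: p; zring. Qed.

(** [zmul_cliffordl] writes [zdot p p' *: q] as a sum of two vanishing products. This is how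
    annihilators of a nonzero element are seen to be totally isotropic; with p' = p it shows that an
    element annihilating a nonzero one is null. *)
Lemma zdot_orthol p p' q : zmul p q = 0 -> zmul p' q = 0 -> q <> 0 ->
  zdot p p' = 0.
Proof.
move=> h h' q0; have := zmul_cliffordl p p' q; rewrite h h' !zmul0r addr0.
by move=> /esym/eqP; rewrite scaler_eq0 => /orP[/eqP //|/eqP].
Qed.

Lemma zdot_orthor p q q' : zmul p q = 0 -> zmul p q' = 0 -> p <> 0 ->
  zdot q q' = 0.
Proof.
move=> h h' p0; have := zmul_clifford p q q'; rewrite h h' !zmul0l addr0.
by move=> /esym/eqP; rewrite scaler_eq0 => /orP[/eqP //|/eqP].
Qed.

Lemma dotNr (x y : 'rV[R]_3) : dot x (- y) = - dot x y.
Proof. by rewrite !dot3E !mxE; ring. Qed.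

Lemma dotC (x y : 'rV[R]_3) : dot x y = dot y x.
Proof. by rewrite !dot3E; ring. Qed.

Lemma dot_ge0 (x : 'rV[R]_3) : 0 <= dot x x.
Proof. by apply: sumr_ge0 => i _; rewrite -expr2 sqr_ge0. Qed.

Lemma dot_eq0 (x : 'rV[R]_3) : dot x x = 0 -> x = 0.
Proof.
move=> /psumr_eq0P x0; apply/rowP => i; rewrite mxE; apply/eqP.
by rewrite -sqrf_eq0 expr2 x0 // => j _; rewrite -expr2 sqr_ge0.
Qed.

Lemma zorn_sq_eq0 (a b : R^o) (x y : 'rV[R]_3) :
  a * a + dot x x + dot y y + b * b = 0 -> (a, x, y, b) = 0 :> zorn R.
Proof.
have ge0 (u : R) : 0 <= u * u by rewrite -expr2 sqr_ge0.
move: (ge0 a) (ge0 b) (dot_ge0 x) (dot_ge0 y) => a_ge0 b_ge0 x_ge0 y_ge0 e.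
have sq0 (u : R) : u * u = 0 -> u = 0.
  by move=> /eqP; rewrite -expr2 sqrf_eq0 => /eqP.
apply: zorn_eq; [apply: sq0|apply: dot_eq0|apply: dot_eq0|apply: sq0]; lra.
Qed.

Lemma zdot_nondeg p : p <> 0 -> exists q, zdot p q = 1.
Proof.
move=> p0.
suff [q pq] : exists q, zdot p q != 0.
  by exists ((zdot p q)^-1 *: q); rewrite zdotZr mulVf.
(* Pairing with this vector gives the Euclidean square a^2 + |x|^2 + |y|^2 + b^2. *)
case: p p0 => [[[a x] y] b] p0; exists ((b, - y, - x, a) : zorn R).
apply/eqP; apply: contra_not p0 => /= h; apply: zorn_sq_eq0; rewrite -h.
by rewrite !dotNr (dotC (- _)) dotNr; ring.
Qed.

Definition zfree2 p q := forall a b : R, a *: p + b *: q = 0 -> a = 0 /\ b = 0.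

Definition zfree3 p q k := forall a b c : R,
  a *: p + b *: q + c *: k = 0 -> [/\ a = 0, b = 0 & c = 0].

Lemma zfree3_2 p q k : zfree3 p q k -> zfree2 p q.
Proof. by move=> h a b e; case: (h a b 0); rewrite // scale0r addr0. Qed.

Lemma zfree3_bar p q k : zfree3 p q k -> zfree3 (zbar p) (zbar q) (zbar k).
Proof.
by move=> h a b c; rewrite -!zbarZ -!zbarD => /zbar_eq0; apply: h.
Qed.

Lemma zfree2_neq0 p q : zfree2 p q -> p <> 0.
Proof.
move=> h p0; case: (h 1 0); first by rewrite p0 scaler0 scale0r addr0.
by move/eqP; rewrite oner_eq0.
Qed.

(** Gram-Schmidt for [zdot]: [b] is dual to q corrected by a multiple of p, then [b'] and the last
    witness remove the remaining cross pairings. *)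
Lemma zdual2 p q : zfree2 p q ->
  exists p' q',
    [/\ zdot p p' = 1, zdot q p' = 0, zdot p q' = 0 & zdot q q' = 1].
Proof.
move=> h; have [a pa] := zdot_nondeg (zfree2_neq0 h).
have [b qb] : exists b, zdot (q + - zdot q a *: p) b = 1.
  apply: zdot_nondeg => e; case: (h (- zdot q a) 1).
    by rewrite scale1r addrC.
  by move=> _ /eqP; rewrite oner_eq0.
pose b' := b + - zdot p b *: a.
have pb' : zdot p b' = 0 by rewrite zdotDr zdotZr pa; ring.
have qb' : zdot q b' = 1.
  by rewrite -qb zdotDr zdotDl zdotZr zdotZl; ring.
exists (a + - zdot q a *: b'), b'; split=> //.
- by rewrite zdotDr zdotZr pa pb'; ring.
- by rewrite zdotDr zdotZr qb'; ring.
Qed.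

Lemma zdual3 p q k : zfree3 p q k ->
  exists c, [/\ zdot p c = 0, zdot q c = 0 & zdot k c = 1].
Proof.
move=> h; have [a [b [pa qa pb qb]]] := zdual2 (zfree3_2 h).
have [c kc] : exists c, zdot (- zdot k a *: p + - zdot k b *: q + k) c = 1.
  apply: zdot_nondeg => e; case: (h (- zdot k a) (- zdot k b) 1).
    by rewrite scale1r.
  by move=> _ _ /eqP; rewrite oner_eq0.
exists (c + (- zdot p c) *: a + (- zdot q c) *: b); split.
- by rewrite !zdotDr !zdotZr pa pb; ring.
- by rewrite !zdotDr !zdotZr qa qb; ring.
- by rewrite -kc !zdotDr !zdotDl !zdotZr !zdotZl; ring.
Qed.

(** A vector c orthogonal to y and z and dual to t strips the factor t off the trilinear map:
    putting l c for l and moving c to the right past y and z turns the hypothesis into (((l y) z^-)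
    c) t^- = 0, and Clifford then gives (l y) z^- = (((l y) z^-) t) c^-. *)
Lemma zmul3_eq0 y z t : zfree3 y z t ->
  zdot y z = 0 -> zdot y t = 0 -> zdot z t = 0 ->
  (forall l, zmul (zmul (zmul l (zbar y)) z) (zbar t) = 0) ->
  forall l, zmul (zmul l y) (zbar z) = 0.
Proof.
move=> /zdual3[c [yc zc tc]] yz yt zt P0 l.
(* Taking adjoints of the right multiplications in [P0] reverses the order of the factors and
   conjugates them. *)
have P0' x : zmul (zmul (zmul x t) (zbar z)) y = 0.
  suff h k : zdot (zmul (zmul (zmul x t) (zbar z)) y) k = 0.
    have [//|/eqP/zdot_nondeg[k]] :=
      eqVneq (zmul (zmul (zmul x t) (zbar z)) y) 0.
    by rewrite h => /esym/eqP; rewrite oner_eq0.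
  by rewrite !zdotMl !zbarK P0 zdotC zdot0l.
have := P0 (zmul l c).
have cy : zdot c y = 0 by rewrite zdotC.
have cz : zdot c z = 0 by rewrite zdotC.
rewrite (zmul_swap l cy) !zmulNl (zmul_swapV _ cz) zmulNl opprK.
have /eqP := zmul_clifford (zmul (zmul l y) (zbar z)) c t.
rewrite zdotC tc scale1r => /eqP + e; rewrite e add0r => <-.
(* Three exchanges bring the product ((l y) z^-) t, up to sign, to ((l t) z^-) y, which is zero by
   [P0']. *)
rewrite (zmul_swapV _ zt) (zmul_swap l yt) !zmulNl opprK (zmul_swapV _ yz).
by rewrite P0' oppr0 zmul0l.
Qed.

(* The witness is ((l z^-) y) t^- for a suitable l, where ^- is [zbar]: by
   [zmul_swap] the trilinear map (z, y, t) |-> ((l z^-) y) t^- is alternating on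
   totally isotropic subspaces. *)
Lemma zann_exists z y t : zfree3 z y t ->
  zdot z z = 0 -> zdot y y = 0 -> zdot t t = 0 ->
  zdot z y = 0 -> zdot z t = 0 -> zdot y t = 0 ->
  exists2 w, w <> 0 & [/\ zmul w z = 0, zmul w y = 0 & zmul w t = 0].
Proof.
move=> fr zz yy tt zy zt yt.
have [[l /eqP l0]|noP] :=
    pselect (exists l, zmul (zmul (zmul l (zbar z)) y) (zbar t) != 0).
  exists (zmul (zmul (zmul l (zbar z)) y) (zbar t)) => //; split.
  - rewrite (zmul_swapV _ zy) !zmulNl (zmul_swap _ zt) zmulNl opprK.
    by rewrite zmul_nullV.
  - by rewrite (zmul_swap _ yt) zmulNl zmul_nullV // oppr0.
  - by rewrite zmul_nullV.
have P0 l : zmul (zmul (zmul l (zbar z)) y) (zbar t) = 0.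
  by apply/eqP/negPn/negP => h; apply: noP; exists l.
(* If the trilinear map vanished identically, so would the bilinear one; multiplied by t this is the
   trilinear hypothesis for the conjugate vectors, so the descent can be repeated on them to give
   [Qb]. *)
have Q l : zmul (zmul l z) (zbar y) = 0 by apply: (zmul3_eq0 fr) P0 l.
have P0b l : zmul (zmul (zmul l (zbar (zbar z))) (zbar y)) (zbar (zbar t)) = 0.
  by rewrite !zbarK Q zmul0l.
have Qb l : zmul (zmul l (zbar z)) y = 0.
  have := zmul3_eq0 (zfree3_bar fr) _ _ _ P0b l.
  by rewrite !zdot_bar zbarK; apply.
have [a [b [za ya zb yb]]] := zdual2 (zfree3_2 fr).
exfalso; apply: (zfree2_neq0 (zfree3_2 fr)).
(* Last descent: with [b] dual to y and orthogonal to z, Clifford expresses z^- by products that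
   vanish by [Q] and [Qb], against z <> 0. *)
apply: zbar_eq0; rewrite -(zmul1l (zbar z)).
set s : zorn R := (1, 0, 0, 1).
have := zmul_clifford (zmul s (zbar z)) b y.
rewrite zdotC yb scale1r Qb zmul0l addr0 => <-.
by rewrite zmul_swapV // zmulNl Q oppr0.
Qed.

Lemma rV_ker (i j : nat) (F : 'rV[R]_i -> 'rV[R]_j) : linear F -> (j < i)%N ->
  exists2 x, x != 0 & F x = 0.
Proof.
move=> linF ji.
pose dlM := GRing.isLinear.Build _ _ _ _ _ linF.
pose dL : {linear 'rV[R]_i -> 'rV[R]_j} := HB.pack F dlM.
have : kermx (lin1_mx dL) != 0.
  rewrite kermx_eq0 /row_free; apply/negP => /eqP h.
  by have := rank_leq_col (lin1_mx dL); rewrite h leqNgt ji.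
move=> /rowV0Pn[x /sub_kermxP xK x0]; exists x => //.
by rewrite -[F x]/(dL x) -mul_rV_lin1.
Qed.

(* The vectors (a, x, -x, a) form a maximal positive definite subspace. *)
Lemma zdot_anisotropic_ortho p q :
  exists c, [/\ zdot c p = 0, zdot c q = 0 & zdot c c != 0].
Proof.
pose C (v : 'rV[R]_(1 + 3)) : zorn R :=
  (lsubmx v 0 0, rsubmx v, - rsubmx v, lsubmx v 0 0).
have Clin a u v : C (a *: u + v) = a *: C u + C v.
  by apply: zorn_eq => /=; rewrite ?linearP ?mxE.
pose F v : 'rV[R]_2 := \row_j (if j == 0 then zdot (C v) p else zdot (C v) q).
have [|//|v v0 Fv] := @rV_ker _ _ F.
  move=> a u v; apply/rowP => j; rewrite !mxE Clin !zdotDl !zdotZl.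
  by case: ifP.
exists (C v); split.
- by have /rowP/(_ 0) := Fv; rewrite !mxE eqxx.
- by have /rowP/(_ 1) := Fv; rewrite !mxE.
apply/eqP; rewrite /zdot /C !dotNr => h.
move/eqP: v0; apply.
have [a0 r0 _ _] : C v = 0.
  by apply: zorn_sq_eq0; rewrite dotNr (dotC (- _)) dotNr -h; ring.
rewrite -(hsubmxK v) r0 (_ : lsubmx v = 0) ?row_mx0 //.
by apply/rowP => i; rewrite [i]ord1 a0 mxE.
Qed.

(* If w and w' were independent, the totally isotropic space ker L_w would
   contain span(z, y, t) and its image under v |-> d^- (c v), where c is
   orthogonal to w and w' and d is orthogonal to w but not to w'.  These six
   vectors are independent, whereas projection to the four-dimensional positive
   definite subspace is injective on totally isotropic subspaces. *)
Lemma zann_unique z y t w w' : zfree3 z y t -> w <> 0 ->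
  zmul w z = 0 -> zmul w y = 0 -> zmul w t = 0 ->
  zmul w' z = 0 -> zmul w' y = 0 -> zmul w' t = 0 ->
  exists a : R, w' = a *: w.
Proof.
move=> fr w0 wz wy wt w'z w'y w't; apply: contrapT => noa.
have fw : zfree2 w w'.
  move=> a b e; have b0 : b = 0.
    apply/eqP/negPn/negP => b0; apply: noa; exists (- (b^-1 * a)).
    move/eqP: e; rewrite addrC addr_eq0 => /eqP/(congr1 ( *:%R b^-1)).
    by rewrite scalerA mulVf // scale1r scalerN scalerA scaleNr.
  split=> //; move/eqP: e; rewrite b0 scale0r addr0 scaler_eq0.
  by move=> /orP[/eqP //|/eqP].
have [_ [d [_ _ wd w'd]]] := zdual2 fw.
have [c [cw cw' cc]] := zdot_anisotropic_ortho w w'.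
have wc0 : zdot w c = 0 by rewrite zdotC.
have w'c0 : zdot w' c = 0 by rewrite zdotC.
pose comb (x : 'rV[R]_3) := x 0 0 *: z + x 0 1 *: y + x 0 (1 + 1) *: t.
have comb_lin a u v : comb (a *: u + v) = a *: comb u + comb v.
  rewrite /comb !mxE !scalerDl -!scalerA !scalerDr.
  by rewrite (addrACA (a *: (_ *: z))) (addrACA (_ + _)).
have wc x : zmul w (comb x) = 0.
  by rewrite !zmulDr !zmulZr wz wy wt !scaler0 !addr0.
have w'c x : zmul w' (comb x) = 0.
  by rewrite !zmulDr !zmulZr w'z w'y w't !scaler0 !addr0.
pose U (x : 'rV[R]_(3 + 3)) :=
  comb (lsubmx x) + zmul (zbar d) (zmul c (comb (rsubmx x))).
have Ulin a u v : U (a *: u + v) = a *: U u + U v.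
  rewrite /U !linearP !comb_lin zmulDr zmulZr zmulDr zmulZr.
  by rewrite [in RHS]scalerDr addrACA.
(* Two exchanges, using that d and c are orthogonal to w, give w (d^- (c v)) = d (c^- (w v)) = 0. *)
have wU x : zmul w (U x) = 0.
  rewrite zmulDr wc add0r (zmul_swaplV _ wd) (zmul_swapl _ wc0).
  by rewrite wc zmul0r oppr0 zmul0r oppr0.
(* Up to scale, this is the projection to the positive definite subspace of the vectors (a, x, -x,
   a). Its kernel consists of the (a, u, u, -a), where the norm is negative definite, so a null
   vector in the kernel is zero. *)
pose F x : 'rV[R]_(1 + 3) := let: (a, u, v, b) := U x in
  row_mx (a + b)%:M (u - v).
have [|//|x x0 Fx] := @rV_ker _ _ F.
  move=> a u v; rewrite /F Ulin.
  case: (U u) => [[[? ?] ?] ?]; case: (U v) => [[[? ?] ?] ?] /=.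
  rewrite scale_row_mx add_row_mx; congr row_mx.
    by apply/rowP => i; rewrite !mxE !ord1 /= !mulr1n /GRing.scale /=; ring.
  by apply/rowP => i; rewrite !mxE; ring.
have Ux0 : U x = 0.
  have := zdot_orthor (wU x) (wU x) w0; move: Fx; rewrite /F.
  case: (U x) => [[[a u] v] b]; rewrite -(row_mx0) => /eq_row_mx[h1 h2].
  have ab : a + b = 0 by have /rowP/(_ 0) := h1; rewrite !mxE mulr1n.
  have uv : u = v by apply/eqP; rewrite -subr_eq0; apply/eqP.
  move: h2 => _; subst v; rewrite (_ : b = - a); last first.
    by apply/eqP; rewrite -addr_eq0 addrC; apply/eqP.
  rewrite /zdot => h; apply: zorn_sq_eq0.
  apply: (mulfI (_ : -1 != 0)); rewrite ?oppr_eq0 ?oner_eq0 // mulr0 -h.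
  by ring.
have combI v : comb v = 0 -> v = 0.
  by move=> /fr[h0 h1 h2]; apply: rV3P; rewrite [RHS]mxE.
(* Multiplying by w' recovers c v from d^- (c v), because [zdot w' d = 1] and w'^- (c v) = - c^- (w'
   v) = 0. Then c v = 0 forces v = 0, since c is not null. *)
have r0 : rsubmx x = 0.
  apply: combI; have := congr1 (zmul w') Ux0.
  rewrite zmulDr w'c add0r zmul0r.
  have := zmul_cliffordl (zbar w') (zbar d) (zmul c (comb (rsubmx x))).
  rewrite !zbarK zdot_bar w'd scale1r (zmul_swapl _ w'c0).
  rewrite w'c zmul0r oppr0 zmul0r addr0 => -> h.
  have := zmul_cliffordl c c (comb (rsubmx x)); rewrite h zmul0r addr0.
  by move=> /esym/eqP; rewrite scaler_eq0 (negPf cc) => /eqP.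
have l0 : lsubmx x = 0.
  apply: combI; rewrite -Ux0 /U r0 {3}/comb !mxE !scale0r !addr0 !zmul0r.
  by rewrite addr0.
by move/eqP: x0; apply; rewrite -(hsubmxK x) l0 r0 row_mx0.
Qed.

(** With c dual to z, the relation z m = 0 gives m = z^- (c m). Exchanging c m and w^- in (z^- (c
    m)) w leaves a multiple of z^-, as z^- w^- is the conjugate of w z. *)
Lemma zmul_ann_bar z w m : z <> 0 -> zmul w z = 0 -> zmul z m = 0 ->
  exists a : R, zmul m w = a *: zbar z.
Proof.
move=> /zdot_nondeg[c zc] wz zm.
have -> : m = zmul (zbar z) (zmul c m).
  have := zmul_cliffordl z c m; rewrite zm zmul0r addr0 => ->.
  by rewrite zc scale1r.
exists (zdot (zmul c m) (zbar w)).
rewrite -(zmul_clifford (zbar z) (zmul c m) (zbar w)).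
by rewrite zbarK -zbarM wz zbar0 zmul0l addr0.
Qed.

(** By [zmul_ann_bar] the product m w is a multiple of both y^- and z^-, which are independent. *)
Lemma zmul_ann2 y z w m : zfree2 y z ->
  zmul w y = 0 -> zmul w z = 0 -> zmul y m = 0 -> zmul z m = 0 ->
  zmul m w = 0.
Proof.
move=> fr wy wz ym zm; have y0 := zfree2_neq0 fr.
have z0 : z <> 0.
  move=> z0; case: (fr 0 1); first by rewrite z0 scaler0 scale0r addr0.
  by move=> _ /eqP; rewrite oner_eq0.
have [a ea] := zmul_ann_bar y0 wy ym; have [b eb] := zmul_ann_bar z0 wz zm.
case: (fr a (- b)) => [|a0 _]; last by rewrite ea a0 scale0r.
by rewrite -(zbarK (_ + _)) zbarD !zbarZ scaleNr -ea -eb subrr zbar0.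
Qed.

(* w y = w' y' is a multiple of m^-, and w^- (w y) = 0, so either m w = 0
   already or w y = 0. *)
Lemma zmul_twisted z y y' w w' m : zfree2 y z -> m <> 0 ->
  zmul w z = 0 -> zmul w' z = 0 ->
  zmul z m = 0 -> zmul y m = 0 -> zmul y' m = 0 ->
  zmul m w' = 0 -> zmul w y = zmul w' y' -> zmul m w = 0.
Proof.
move=> fr m0 wz w'z zm ym y'm mw' e.
have z0 : z <> 0 by move=> z0; case: (fr 0 1) => [|_ /eqP];
  rewrite ?oner_eq0 // z0 scaler0 scale0r addr0.
have [a ea] := zmul_ann_bar m0 y'm mw'.
have := zmul_nulll y (zdot_orthol wz wz z0).
rewrite e ea zmulZr -zbarM => /eqP; rewrite scaler_eq0 => /orP[/eqP a0|/eqP].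
  by apply: zmul_ann2 fr _ _ _ _ => //; rewrite e ea a0 scale0r.
exact: zbar_eq0.
Qed.

(* If m wu = a z^- and m wv = b z^-, then w' = b wu - a wv is annihilated by m,
   and y = b zu - a zv satisfies wu y = w' zu and wv y = w' zv. *)
Lemma zmul_integrable z zu zv wu wv m : zfree3 z zu zv -> m <> 0 ->
  zmul wu z = 0 -> zmul wv z = 0 ->
  zmul z m = 0 -> zmul zu m = 0 -> zmul zv m = 0 ->
  zmul wu zv = zmul wv zu ->
  zmul m wu = 0 /\ zmul m wv = 0.
Proof.
move=> fr m0 wuz wvz zm zum zvm e.
have z0 : z <> 0 := zfree2_neq0 (zfree3_2 fr).
have [a ea] := zmul_ann_bar z0 wuz zm; have [b eb] := zmul_ann_bar z0 wvz zm.
have [a0|ab] := pselect (a = 0 /\ b = 0).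
  by case: a0 => a0 b0; rewrite ea eb a0 b0 !scale0r.
pose w' := b *: wu + - a *: wv; pose y := b *: zu + - a *: zv.
have fry : zfree2 y z.
  move=> r s h; have [|-> rb ra] := fr s (r * b) (- (r * a)).
    by rewrite -h /y scalerDr !scalerA mulrN [RHS]addrC addrA.
  split=> //; apply/eqP/negPn/negP => r0; apply: ab.
  move/eqP: ra; rewrite oppr_eq0 mulf_eq0 (negPf r0) => /eqP.
  by move/eqP: rb; rewrite mulf_eq0 (negPf r0) => /eqP.
have w'z : zmul w' z = 0 by rewrite zmulDl !zmulZl wuz wvz !scaler0 addr0.
have ym : zmul y m = 0 by rewrite zmulDl !zmulZl zum zvm !scaler0 addr0.
have mw' : zmul m w' = 0.
  by rewrite zmulDr !zmulZr ea eb !scalerA -scalerDl mulrC mulNr subrr scale0r.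
split.
- apply: (@zmul_twisted z y zu wu w' m) => //.
  by rewrite zmulDr zmulDl !(zmulZl, zmulZr) e.
- apply: (@zmul_twisted z y zv wv w' m) => //.
  by rewrite zmulDr zmulDl !(zmulZl, zmulZr) e.
Qed.

End ZornAlgebra.

(** * Symmetry of second derivatives *)

Section Schwarz.
Variables (R : realType) (V : normedModType R).
Implicit Types (f fu fv fvu fuv : V -> R^o) (x u v : V).

Lemma derivable_line f x u (t : R) : derivable f (x + t *: u) u ->
  is_derive t 1 (fun s : R => f (x + s *: u) : R^o) ('D_u f (x + t *: u)).
Proof.
move=> fu.
have E : (fun h : R => h^-1 *: (f (x + (h *: 1 + t) *: u) - f (x + t *: u))) =
         (fun h : R => h^-1 *: (f (h *: u + (x + t *: u)) - f (x + t *: u))).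
  by apply/funext => h; rewrite [h *: 1]mulr1 scalerDl addrCA.
apply: DeriveDef.
- by rewrite /derivable E.
- by rewrite /derive E.
Qed.

Lemma MVT_line f fu x u (h : R) : 0 < h ->
  (forall t, 0 <= t <= h -> is_derive (x + t *: u) u f (fu (x + t *: u))) ->
  exists2 t, 0 <= t <= h & f (x + h *: u) - f x = h * fu (x + t *: u).
Proof.
move=> h0 dfu; pose g (s : R) : R^o := f (x + s *: u).
have gd t : 0 <= t <= h -> is_derive t 1 g (fu (x + t *: u)).
  by move=> /dfu[df <-]; exact: derivable_line.
have [|||t] := @MVT R g (fun t => fu (x + t *: u)) 0 h.
- exact: h0.
- by move=> t; rewrite in_itv /= => /andP[t0 th]; apply: gd; rewrite !ltW.
- apply: derivable_within_continuous => t; rewrite in_itv /= => th.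
  by have [] := gd t th.
rewrite in_itv /= => /andP[t0 th]; rewrite subr0 /g scale0r addr0 => ->.
by exists t; rewrite 1?mulrC // !ltW.
Qed.

Lemma is_derive_shift_arg f df c x u :
  is_derive (x + c) u f df -> is_derive x u (fun y => f (y + c)) df.
Proof.
move=> [fu <-].
have E : (fun h : R => h^-1 *: (f (h *: u + x + c) - f (x + c))) =
         (fun h : R => h^-1 *: (f (h *: u + (x + c)) - f (x + c))).
  by apply/funext => h; rewrite addrA.
apply: DeriveDef.
- by rewrite /derivable E.
- by rewrite /derive E.
Qed.

(** Two uses of the mean value theorem: along u for the increment of f in direction h v, then along
    v for [fu]. *)
Lemma second_difference f fu fvu x u v (h : R) : 0 < h ->
  (forall s t, 0 <= s <= h -> 0 <= t <= h ->
     is_derive (x + s *: u + t *: v) u f (fu (x + s *: u + t *: v)) /\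
     is_derive (x + s *: u + t *: v) v fu (fvu (x + s *: u + t *: v))) ->
  exists s t, [/\ 0 <= s <= h, 0 <= t <= h &
    f (x + h *: u + h *: v) - f (x + h *: u) - (f (x + h *: v) - f x) =
    h * (h * fvu (x + s *: u + t *: v))].
Proof.
move=> h0 fuv; have h1 : 0 <= h <= h by rewrite lexx ltW.
have h2 : (0 : R) <= 0 <= h by rewrite lexx ltW.
pose F y : R^o := f (y + h *: v) - f y.
have dF s : 0 <= s <= h -> is_derive (x + s *: u) u F
    (fu (x + s *: u + h *: v) - fu (x + s *: u)).
  move=> sh; have [d1 _] := fuv s h sh h1; have [d0 _] := fuv s 0 sh h2.
  rewrite scale0r addr0 in d0.
  exact: (is_deriveB (is_derive_shift_arg d1) d0).
have [s sh] := MVT_line (fu := fun y => fu (y + h *: v) - fu y) h0 dF.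
rewrite {1 2}/F => ->.
have dfu t : 0 <= t <= h -> is_derive (x + s *: u + t *: v) v fu
    (fvu (x + s *: u + t *: v)).
  by move=> th; have [] := fuv s t sh th.
have [t th ->] := MVT_line h0 dfu.
by exists s, t.
Qed.

Lemma near_parallelogram (P : set V) x u v : nbhs x P ->
  exists2 h : R, 0 < h &
    forall s t, 0 <= s <= h -> 0 <= t <= h -> P (x + s *: u + t *: v).
Proof.
(* The summand 1 keeps M positive when u = v = 0 and makes the final estimate strict. *)
move=> /nbhs_ballP[e /= e0 eP]; pose M := `|u| + `|v| + 1.
have M0 : 0 < M by rewrite ltr_pwDr // addr_ge0.
exists (e / M); first by rewrite divr_gt0.
move=> s t /andP[s0 sh] /andP[t0 th]; apply: eP.
rewrite -ball_normE /= -addrA opprD addrA subrr sub0r normrN.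
apply: le_lt_trans (ler_normD _ _) _; rewrite !normrZ !ger0_norm //.
apply: (@le_lt_trans _ _ (e / M * `|u| + e / M * `|v|)).
  by rewrite lerD // ler_wpM2r.
rewrite -mulrDr -mulrA gtr_pMr // mulrC ltr_pdivrMr // mul1r.
by rewrite ltrDl ltr01.
Qed.

Lemma derive_comm f fu fv fvu fuv x u v :
  (\forall y \near x, is_derive y u f (fu y)) ->
  (\forall y \near x, is_derive y v f (fv y)) ->
  (\forall y \near x, is_derive y v fu (fvu y)) ->
  (\forall y \near x, is_derive y u fv (fuv y)) ->
  {for x, continuous fvu} -> {for x, continuous fuv} -> fvu x = fuv x.
Proof.
move=> dfu dfv dfvu dfuv cvu cuv.
apply/eqP; rewrite -subr_eq0 -normr_eq0; apply/eqP.
apply/le_anti; rewrite normr_ge0 andbT; apply/ler_addgt0Pl => e e0.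
rewrite addr0; have e2 : 0 < e / 2 by rewrite divr_gt0.
have near_cvu : \forall y \near x, `|fvu x - fvu y| < e / 2.
  exact: (@cvgr_dist_lt _ _ _ _ _ _ _ cvu _ e2).
have near_cuv : \forall y \near x, `|fuv x - fuv y| < e / 2.
  exact: (@cvgr_dist_lt _ _ _ _ _ _ _ cuv _ e2).
have FI := @filterI _ (nbhs x) (nbhs_filter x).
have [h1 h10 N1] := near_parallelogram u v (FI _ _ (FI _ _ dfu dfvu) near_cvu).
have [h2 h20 N2] := near_parallelogram v u (FI _ _ (FI _ _ dfv dfuv) near_cuv).
pose h := Num.min h1 h2; have h0 : 0 < h by rewrite lt_min h10.
have le1 s : 0 <= s <= h -> 0 <= s <= h1.
  by rewrite le_min => /andP[-> /andP[-> _]].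
have le2 s : 0 <= s <= h -> 0 <= s <= h2.
  by rewrite le_min => /andP[-> /andP[_ ->]].
have [|s [t [sh th E]]] := @second_difference f fu fvu x u v h h0.
  by move=> s t /le1 sh /le1 th; have [[d1 d2] _] := N1 s t sh th.
have [|s' [t' [sh' th' E']]] := @second_difference f fv fuv x v u h h0.
  by move=> s' t' /le2 sh' /le2 th'; have [[d1 d2] _] := N2 s' t' sh' th'.
have [_ B1] := N1 s t (le1 _ sh) (le1 _ th).
have [_ B2] := N2 s' t' (le2 _ sh') (le2 _ th').
(* The second difference is symmetric in u and v, so [fvu] at one intermediate point equals [fuv] at
   the other. This common value is within e / 2 of both [fvu x] and [fuv x]. *)
have cancel (a b c d X Y : R) : a - b - (c - d) = h * (h * X) ->
    a - c - (b - d) = h * (h * Y) -> X = Y.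
  move=> EX EY; do 2!apply: (mulfI (lt0r_neq0 h0)).
  by rewrite -EX -EY; ring.
rewrite (addrAC x (h *: v)) in E'.
rewrite (cancel _ _ _ _ _ _ E E') in B1.
have tri (a b c : R) : `|a - c| < e / 2 -> `|b - c| < e / 2 -> `|a - b| <= e.
  move=> ac bc; have -> : a - b = (a - c) - (b - c) by ring.
  by apply: le_trans (ler_normB _ _) _; apply: ltW; rewrite (splitr e) ltrD.
exact: tri B1 B2.
Qed.

End Schwarz.

(** * Linear forms on R^{4,4} and the product rule *)

Section ZornForms.
Variable R : realType.
Implicit Types (u v : R44 R) (p q k : zorn R).

Lemma rhoP (a : R) u v : rho (a *: u + v) = a *: rho u + rho v.
Proof.
move: u v => [[[x s] y] t] [[[x' s'] y'] t'].
by apply: zorn_eq; rewrite //= scalerN opprD.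
Qed.

Lemma rhoZ (a : R) u : rho (a *: u) = a *: rho u.
Proof.
move: u => [[[x s] y] t].
by apply: zorn_eq; rewrite //= scalerN.
Qed.

Lemma rhoD u v : rho (u + v) = rho u + rho v.
Proof. by rewrite -[u]scale1r rhoP !scale1r. Qed.

Definition rhoV Z : R44 R := let: (a, x, y, b) := Z in (x, a, y, - b).

Lemma rhoK : cancel (@rho R) rhoV.
Proof. by move=> [[[x s] y] t] /=; rewrite opprK. Qed.

Lemma rhoVK : cancel rhoV (@rho R).
Proof. by move=> [[[a x] y] b] /=; rewrite opprK. Qed.

Lemma rho0 : rho 0 = 0 :> zorn R.
Proof. by rewrite -(scale0r (0 : R44 R)) rhoZ scale0r. Qed.

Lemma rho_eq0 v : rho v = 0 -> v = 0.
Proof. by rewrite -rho0 => /(can_inj rhoK). Qed.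

Lemma rho_neq0 v : v != 0 -> rho v <> 0.
Proof. by move=> /eqP v0 /rho_eq0. Qed.

Lemma qform_zdot v : zdot (rho v) (rho v) = - (qform v + qform v).
Proof. by move: v => [[[x s] y] t]; rewrite /zdot /qform /=; ring. Qed.

Lemma isotropic_zdot v : qform v = 0 <-> zdot (rho v) (rho v) = 0.
Proof. by rewrite qform_zdot; split=> [->|/eqP]; [ring|move/eqP; lra]. Qed.

(** By nondegeneracy these forms separate points and furnish an affine chart around every line. *)
Definition zform q v : R^o := zdot (rho v) q.

Lemma zformZ q (a : R) v : zform q (a *: v) = a * zform q v.
Proof. by rewrite /zform rhoZ zdotZl. Qed.

Lemma zformD q u v : zform q (u + v) = zform q u + zform q v.
Proof. by rewrite /zform rhoD zdotDl. Qed.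

Fact zform_is_linear q : linear (zform q).
Proof. by move=> a u v; rewrite /zform rhoP zdotDl zdotZl. Qed.

HB.instance Definition _ q :=
  GRing.isLinear.Build R (R44 R) R^o _ (zform q) (zform_is_linear q).

(** Scalar components of the Zorn product, to which the differential of a continuous bilinear form
    applies. *)
Definition zform2 k u v : R^o := zdot (zmul (rho u) (rho v)) k.

Fact zform2_is_bilinear k :
  bilinear_for
    (GRing.Scale.Law.clone _ _ *:%R _) (GRing.Scale.Law.clone _ _ *:%R _)
    (zform2 k).
Proof.
split=> [u'|u] a x y /=.
- by rewrite /zform2 rhoP zmulDl zmulZl zdotDl zdotZl.
- by rewrite /zform2 rhoP zmulDr zmulZr zdotDl zdotZl.
Qed.

HB.instance Definition _ k :=
  bilinear_isBilinear.Build R (R44 R) (R44 R) R^o _ _ (zform2 k)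
    (zform2_is_bilinear k).

Section Continuity.
Variable T : topologicalType.
Implicit Types (F G : T -> R) (f g : T -> 'rV[R]_3) (x : T).

Lemma contD F G :
  continuous F -> continuous G -> continuous (fun x => F x + G x).
Proof.
by move=> cF cG x; exact: (@continuousD R R^o T F G x (cF x) (cG x)).
Qed.

Lemma contN F : continuous F -> continuous (fun x => - F x).
Proof. by move=> cF x; exact: (@continuousN R R^o T F x (cF x)). Qed.

Lemma contM F G :
  continuous F -> continuous G -> continuous (fun x => F x * G x).
Proof. by move=> cF cG x; exact: (@continuousM R T F G x (cF x) (cG x)). Qed.

Definition coordwise_continuous f := forall i, continuous (fun x => f x 0 i).

Lemma continuous_dot f g :
  coordwise_continuous f -> coordwise_continuous g ->
  continuous (fun x => dot (f x) (g x)).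
Proof.
move=> cf cg; rewrite (_ : (fun x => _) = (fun x => f x 0 0 * g x 0 0 +
  f x 0 1 * g x 0 1 + f x 0 (1 + 1) * g x 0 (1 + 1))); last first.
  by apply/funext => r; rewrite dot3E.
by apply: contD; [apply: contD|]; exact: contM.
Qed.

Lemma coordwise_continuous_cross f g :
  coordwise_continuous f -> coordwise_continuous g ->
  coordwise_continuous (fun x => cross (f x) (g x)).
Proof.
move=> cf cg i; rewrite (_ : (fun x => _) =
  (fun x => f x 0 (i + 1) * g x 0 (i + 2) - f x 0 (i + 2) * g x 0 (i + 1))).
  by apply: contD; [|apply: contN]; exact: contM.
by apply/funext => r; rewrite mxE.
Qed.

Lemma coordwise_continuousD f g :
  coordwise_continuous f -> coordwise_continuous g ->
  coordwise_continuous (fun x => f x + g x).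
Proof.
move=> cf cg i; rewrite (_ : (fun x => _) = (fun x => f x 0 i + g x 0 i)).
  exact: contD.
by apply/funext => r; rewrite mxE.
Qed.

Lemma coordwise_continuousZ F f :
  continuous F -> coordwise_continuous f ->
  coordwise_continuous (fun x => F x *: f x).
Proof.
move=> cF cf i; rewrite (_ : (fun x => _) = (fun x => F x * f x 0 i)).
  exact: contM.
by apply/funext => r; rewrite mxE.
Qed.

Lemma coordwise_continuousN f :
  coordwise_continuous f -> coordwise_continuous (fun x => - f x).
Proof.
move=> cf i; rewrite (_ : (fun x => _) = (fun x => - f x 0 i)).
  exact: contN.
by apply/funext => r; rewrite mxE.
Qed.

End Continuity.

Lemma zform2_continuous k :
  continuous (fun P : R44 R * R44 R => zform2 k P.1 P.2).
Proof.
case: k => [[[ka kx] ky] kb].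
have cfst (U W : normedModType R) : continuous (@fst U W).
  by move=> ?; exact: cvg_fst.
have csnd (U W : normedModType R) : continuous (@snd U W).
  by move=> ?; exact: cvg_snd.
pose T : topologicalType := (R44 R * R44 R)%type.
have comp (U W : topologicalType) (f : T -> U) (g : U -> W) :
    continuous f -> continuous g -> continuous (fun P => g (f P)).
  by move=> cf cg P; apply: (continuous_comp (cf P)); exact: cg.
have cx (f : T -> R44 R) : continuous f ->
    [/\ coordwise_continuous (fun P => (f P).1.1.1),
      continuous (fun P => (f P).1.1.2 : R),
      coordwise_continuous (fun P => (f P).1.2) &
      continuous (fun P => (f P).2 : R)].
  move=> cf; have c1 := comp _ _ _ _ cf (@cfst _ _).
  have c2 := comp _ _ _ _ c1 (@cfst _ _).
  split.
  - move=> i; apply: (comp _ _ (fun P => (f P).1.1.1) (fun M => M 0 i)).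
      exact: (comp _ _ _ _ c2 (@cfst _ _)).
    exact: coord_continuous.
  - exact: (comp _ _ _ _ c2 (@csnd _ _)).
  - move=> i; apply: (comp _ _ (fun P => (f P).1.2) (fun M => M 0 i)).
      exact: (comp _ _ _ _ c1 (@csnd _ _)).
    exact: coord_continuous.
  - exact: (comp _ _ _ _ cf (@csnd _ _)).
have [x1 s1 y1 t1] := cx fst (@cfst _ _).
have [x2 s2 y2 t2] := cx snd (@csnd _ _).
have cst_c (c : R) : continuous (fun _ : T => c) by move=> ?; exact: cvg_cst.
have cst_cc (c : 'rV[R]_3) : coordwise_continuous (fun _ : T => c).
  by move=> i ?; exact: cvg_cst.
rewrite (_ : (fun P => _) = (fun P : T => zdot (zmul
  (P.1.1.1.2, P.1.1.1.1, P.1.1.2, - P.1.2)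
  (P.2.1.1.2, P.2.1.1.1, P.2.1.2, - P.2.2)) (ka, kx, ky, kb))); last first.
  by apply/funext => -[[[[? ?] ?] ?] [[[? ?] ?] ?]].
have nt1 := contN t1; have nt2 := contN t2.
have ca := contD (contM s1 s2) (continuous_dot x1 y2).
have cX := coordwise_continuousD (coordwise_continuousD
  (coordwise_continuousZ s1 x2) (coordwise_continuousZ nt2 x1))
  (coordwise_continuousN (coordwise_continuous_cross y1 y2)).
have cY := coordwise_continuousD (coordwise_continuousD
  (coordwise_continuousZ s2 y1) (coordwise_continuousZ nt1 y2))
  (coordwise_continuous_cross x1 x2).
have cb := contD (continuous_dot x2 y1) (contM nt1 nt2).
exact: (contD (contD (contD (contM ca (cst_c kb)) (contM (cst_c ka) cb))
  (contN (continuous_dot cX (cst_cc ky))))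
  (contN (continuous_dot (cst_cc kx) cY))).
Qed.
Lemma zmul1r p : zmul p ((1, 0, 0, 1) : zorn R) = p.
Proof.
have := zmul1l (zbar p); move/(congr1 (fun w : zorn R => zbar w)).
by rewrite zbarM zbarK /zbar !oppr0.
Qed.

Lemma zform_continuous q : continuous (zform q).
Proof.
have E v : zform q v = zform2 q v (rhoV (1, 0, 0, 1)).
  by rewrite /zform2 rhoVK zmul1r.
move=> v; rewrite (_ : zform q = (fun P : R44 R * R44 R => zform2 q P.1 P.2) \o
  (fun v => (v, rhoV (1, 0, 0, 1)))); last exact/funext.
apply: continuous_comp; last exact: zform2_continuous.
exact/differentiable_continuous/differentiable_pair.
Qed.

Lemma zform_sep u v : (forall q, zform q u = zform q v) -> u = v.
Proof.
move=> uv; apply/eqP; rewrite -subr_eq0; apply/negPn/negP.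
move=> /rho_neq0/zdot_nondeg[q].
rewrite -/(zform q (u - v)) linearB /= uv subrr.
by move/esym/eqP; rewrite oner_eq0.
Qed.

Section Derivatives.
Variable V : normedModType R.
Implicit Types (f g : V -> R44 R) (x d e : V).

Lemma is_derive_zform q f x d : differentiable f x ->
  is_derive x d (fun y => zform q (f y)) (zform q ('D_d f x)).
Proof.
move=> df; have dq : differentiable (zform q) (f x).
  exact/linear_differentiable/zform_continuous.
have dqf := differentiable_comp df dq.
apply: DeriveDef; first exact: (diff_derivable dqf).
rewrite (deriveE _ dqf) diff_comp // diff_lin; last exact: zform_continuous.
by rewrite (deriveE _ df).
Qed.

(** The product rule, one component at a time: were the sum nonzero, some k would pair with it to 1,
    whereas that pairing is the derivative of a locally vanishing function. *)
Lemma derive_zmul_eq0 f g x d : differentiable f x -> differentiable g x ->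
  (\forall y \near x, zmul (rho (f y)) (rho (g y)) = 0) ->
  zmul (rho ('D_d f x)) (rho (g x)) + zmul (rho (f x)) (rho ('D_d g x)) = 0.
Proof.
move=> df dg fg0; rewrite (deriveE d df) (deriveE d dg).
apply: contrapT => /zdot_nondeg[k].
pose B (P : R44 R * R44 R) := zform2 k P.1 P.2.
have dfg := differentiable_pair df dg.
have dB : differentiable B (f x, g x).
  exact/(@differentiable_bilin _ _ _ _ (zform2 k))/zform2_continuous.
have dBfg := differentiable_comp dfg dB.
have D0 : 'D_d (B \o (fun y => (f y, g y))) x = 0.
  rewrite (@near_eq_derive _ _ _ _ (cst 0)) ?derive_cst //.
  by near do rewrite /B /zform2 /= (near fg0) ?zdot0l //.
have E (P Q : R44 R * R44 R) :
    'd B P Q = zform2 k P.1 Q.2 + zform2 k Q.1 P.2 :> R^o.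
  by rewrite (@diff_bilin _ _ _ _ (zform2 k)) //; exact: zform2_continuous.
have : 'd B (f x, g x) ('d f x d, 'd g x d) = 0 :> R^o.
  have Ep : 'd (fun y => (f y, g y)) x d = ('d f x d, 'd g x d).
    by rewrite diff_pair.
  by rewrite -Ep -D0 (deriveE _ dBfg) diff_comp.
rewrite E zdotDl addrC /zform2 => -> /esym/eqP.
by rewrite oner_eq0.
Unshelve. all: by end_near. Qed.

Lemma Ck_derive_comm (U : set V) f x d e : open U -> U x -> Ck 2 U f ->
  'D_e (fun y => 'D_d f y) x = 'D_d (fun y => 'D_e f y) x.
Proof.
move=> oU Ux [df Df].
have nU : \forall y \near x, U y by exact: open_nbhs_nbhs.
apply: zform_sep => q.
have dq d1 : \forall y \near x,
    is_derive y d1 (fun y => zform q (f y)) (zform q ('D_d1 f y)).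
  by apply: filterS nU => y Uy; apply: is_derive_zform; exact: df.
have ddq d1 d2 : \forall y \near x,
    is_derive y d2 (fun y => zform q ('D_d1 f y))
      (zform q ('D_d2 (fun y => 'D_d1 f y) y)).
  apply: filterS nU => y Uy; apply: is_derive_zform.
  by have [+ _] := Df d1; apply.
have cq d1 d2 : {for x, continuous (fun y =>
    zform q ('D_d2 (fun y => 'D_d1 f y) y))}.
  have [_ /(_ d2) /(_ x Ux) c] := Df d1.
  by apply: (continuous_comp c); exact: zform_continuous.
exact: (derive_comm (dq d) (dq e) (ddq d e) (ddq e d) (cq d e) (cq e d)).
Qed.

End Derivatives.
End ZornForms.

(** * The quadric *)

Section Lines.
Variable R : realType.
Implicit Types (z : quadric R) (v : R44 R).

Lemma vline_scale v w (a : R) : v != 0 -> v = a *: w -> <[w]>%VS = <[v]>%VS.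
Proof.
move=> v0 e; have a0 : a != 0.
  by apply: contra_neq v0 => a0; rewrite e a0 scale0r.
apply: subv_anti; rewrite -!memvE; apply/andP; split; apply/vlineP.
- by exists a^-1; rewrite e scalerA mulVf // scale1r.
- by exists a.
Qed.

Lemma dim1_vpick (l : {vspace R44 R}) : \dim l = 1%N ->
  vpick l != 0 /\ l = <[vpick l]>%VS.
Proof.
move=> d1; have p0 : vpick l != 0 by rewrite vpick0 -dimv_eq0 d1.
split=> //; apply/esym/eqP; rewrite eqEdim -memvE memv_pick.
by rewrite dim_vline p0 d1.
Qed.

Lemma line_vpick z : vpick (line z) != 0 /\ line z = <[vpick (line z)]>%VS.
Proof. by apply: dim1_vpick; apply/eqP; exact: (valP (val z)). Qed.

Lemma lineP z v : v != 0 -> v \in line z -> line z = <[v]>%VS.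
Proof.
have [_ lz] := line_vpick z; move=> v0; rewrite {1}lz => /vlineP[a e].
by rewrite lz; exact: vline_scale v0 e.
Qed.

Lemma line_inj : injective (@line R).
Proof. by move=> z z' /val_inj/val_inj. Qed.

Lemma line_neq0 z : exists2 v, v != 0 & v \in line z.
Proof.
exists (vpick (line z)); last exact: memv_pick.
by have [] := line_vpick z.
Qed.

Lemma qformZ (a : R) v : qform (a *: v) = a * a * qform v.
Proof.
move: v => [[[x s] y] t]; rewrite /qform /= !dot3E !mxE /GRing.scale /=; ring.
Qed.

Lemma quadric_line v : v != 0 -> qform v = 0 ->
  exists z : quadric R, line z = <[v]>%VS.
Proof.
move=> v0 qv.
have d1 : \dim <[v]>%VS == 1%N by rewrite dim_vline v0.
pose l : Defs.proj R := exist _ <[v]>%VS d1.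
have lq : l \in quadric R.
  by apply/mem_set => w /= /vlineP[a ->]; rewrite qformZ qv mulr0.
by exists (SigSub lq).
Qed.

Lemma affine_domP (l : {linear R44 R -> R^o}) z v : v != 0 -> v \in line z ->
  affine_dom l (val z) <-> l v != 0.
Proof.
move=> v0 vz; split=> [[w]|lv]; last by exists v; [exact: vz|exact: lv].
rewrite -/(line z) (lineP v0 vz) => /vlineP[a ->].
by rewrite linearZ; apply: contra_neq => ->; exact: mulr0.
Qed.

Lemma affine_coordP (l : {linear R44 R -> R^o}) z : affine_dom l (val z) ->
  [/\ l (affine_coord l (val z)) = 1, affine_coord l (val z) != 0 &
      affine_coord l (val z) \in line z].
Proof.
move=> lz; have [p0 _] := line_vpick z; have pz := memv_pick (line z).
have lp := (affine_domP l p0 pz).1 lz.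
have lv : l (affine_coord l (val z)) = 1.
  by rewrite linearZ; exact: mulVf lp.
split; [exact: lv| |exact: memvZ pz].
by apply/eqP => v0; move: lv; rewrite v0 linear0 => /esym/eqP; rewrite oner_eq0.
Qed.

Lemma zform_dom z : exists q, affine_dom (zform q) (val z).
Proof.
have [v v0 vz] := line_neq0 z.
have [q vq] := zdot_nondeg (rho_neq0 v0).
by exists q; apply/(affine_domP _ v0 vz); rewrite /= /zform vq oner_eq0.
Qed.

Lemma rho_line z v : v != 0 -> v \in line z ->
  @rho R @` [set` line z] = [set a *: rho v | a in [set: R]].
Proof.
move=> v0 vz; rewrite (lineP v0 vz); apply/seteqP; split=> w /=.
- by case=> u /vlineP[a ->] <-; exists a; rewrite ?rhoZ.
- by case=> a _ <-; exists (a *: v); rewrite ?rhoZ // memvZ ?memv_line.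
Qed.

End Lines.

(** * Local lifts *)

Section Lifts.
Variables (R : realType) (S : topologicalType) (A : smooth_surface R S).
Implicit Types (phi : S -> quadric R) (c : chart R S) (p : S) (U : set S).

Lemma chart_image_open c U : open U -> open (cfun c @` (cdom c `&` U)).
Proof.
move=> oU; rewrite openE => _ [p [cp Up] <-].
have nI : nbhs (cfun c p) (cfun c @` cdom c).
  by apply: open_nbhs_nbhs; split; [exact: cimg_open|exists p].
have nU : nbhs (cfun c p) (cinv c @^-1` U).
  apply: (@cinv_cont _ _ c p cp); rewrite cfunK //.
  exact: open_nbhs_nbhs.
apply: filterS (filterI nI nU) => _ [[q cq <-]] /=.
by rewrite cfunK // => Uq; exists q.
Qed.

(** The lift normalised by [zform q = 1], read in the chart c; it is meaningful where [zform q] does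
    not vanish on the line, which [lift_at] records. *)
Definition coord_lift q phi c : 'rV[R]_2 -> R44 R :=
  in_coord (zform q) phi \o cinv c.

Definition lift_at q phi c p :=
  [/\ atlas A c, cdom c p & affine_dom (zform q) (val (phi p))].

Lemma lift_exists phi p c : atlas A c -> cdom c p ->
  exists q, lift_at q phi c p.
Proof. by move=> Ac cp; have [q] := zform_dom (phi p); exists q. Qed.

Section OneLift.
Variables (phi : S -> quadric R) (q : zorn R) (c : chart R S).
Hypothesis sphi : smooth A phi.

Definition lift_dom : set 'rV[R]_2 :=
  cfun c @` (cdom c `&` [set p | affine_dom (zform q) (val (phi p))]).

Lemma lift_dom_open : open lift_dom.
Proof. by apply: chart_image_open; have [] := sphi (zform q). Qed.

Lemma lift_dom_at p : lift_at q phi c p -> lift_dom (cfun c p).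
Proof. by case=> _ cp lp; exists p. Qed.

Lemma lift_domP y : atlas A c -> lift_dom y ->
  [/\ lift_at q phi c (cinv c y), cfun c (cinv c y) = y &
      cdom c (cinv c y)].
Proof. by move=> Ac [p [cp lp] <-]; rewrite cfunK. Qed.

Lemma lift_smooth k : atlas A c -> Ck k lift_dom (coord_lift q phi c).
Proof. by move=> Ac; have [_ /(_ c Ac k)] := sphi (zform q). Qed.

Lemma lift_near p : lift_at q phi c p -> \forall y \near cfun c p, lift_dom y.
Proof.
move=> h; apply: open_nbhs_nbhs; split; [exact: lift_dom_open|].
exact: lift_dom_at.
Qed.

Lemma lift_diff p : lift_at q phi c p ->
  differentiable (coord_lift q phi c) (cfun c p).
Proof.
move=> h; have [Ac _ _] := h.
by have [+ _] := @lift_smooth 1 Ac; apply; exact: lift_dom_at.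
Qed.

Lemma lift_diff2 p e : lift_at q phi c p ->
  differentiable (fun y => 'D_e (coord_lift q phi c) y) (cfun c p).
Proof.
move=> h; have [Ac _ _] := h.
by have [_ /(_ e)[+ _]] := @lift_smooth 2 Ac; apply; exact: lift_dom_at.
Qed.

Lemma liftP p : lift_at q phi c p ->
  [/\ zform q (coord_lift q phi c (cfun c p)) = 1,
      coord_lift q phi c (cfun c p) != 0 &
      coord_lift q phi c (cfun c p) \in line (phi p)].
Proof.
by case=> _ cp /affine_coordP; rewrite /coord_lift /= /in_coord cfunK.
Qed.

Lemma zform_derive_lift p e : lift_at q phi c p ->
  zform q ('D_e (coord_lift q phi c) (cfun c p)) = 0.
Proof.
move=> h; have [Ac _ _] := h.
have [_ <-] := is_derive_zform q e (lift_diff h).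
rewrite (@near_eq_derive _ _ R^o _ (cst (1 : R^o))) ?derive_cst //.
apply: filterS (lift_near h) => y /(lift_domP Ac)[/liftP[+ _ _] cy _].
by rewrite cy.
Qed.

Lemma lift_local : local_lift A phi
  [set p | affine_dom (zform q) (val (phi p))] (in_coord (zform q) phi).
Proof.
have [oU sU] := sphi (zform q); split=> // p lp.
by have [_ ? ?] := affine_coordP lp.
Qed.

Lemma lift_is_Vp p : lift_at q phi c p ->
  is_Vp A phi p [set v | exists (a : R) e,
    v = a *: coord_lift q phi c (cfun c p) +
        'D_e (coord_lift q phi c) (cfun c p)].
Proof.
move=> h; have [Ac cp lp] := h.
exists [set p | affine_dom (zform q) (val (phi p))].
exists (in_coord (zform q) phi), c.
split=> //; first exact: lift_local.
apply/seteqP; split=> v [a [e ->]]; exists a, e;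
  by rewrite /coord_lift /= cfunK // (deriveE _ (lift_diff h)).
Qed.

End OneLift.

Lemma derive_scale_zform (V : normedModType R) (g : V -> R^o) (f F : V -> R44 R)
    x e : differentiable g x -> differentiable f x -> differentiable F x ->
  (\forall y \near x, F y = (g y : R) *: f y) ->
  'D_e F x = (g x : R) *: 'D_e f x + ('D_e g x : R) *: f x.
Proof.
move=> dg df dF E; apply: zform_sep => k.
have [_ <-] := is_derive_zform k e dF.
rewrite (@near_eq_derive _ _ _ _ ((g : V -> R) * (fun y => zform k (f y)))).
  have [dkf Dk] := is_derive_zform k e df.
  rewrite (@deriveM R V g (fun y => zform k (f y)) x e (diff_derivable dg) dkf).
  rewrite Dk linearD !linearZ /=; congr (_ + _); exact: mulrC.
by apply: filterS E => y ->; rewrite linearZ.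
Qed.

(** Together with [lift_is_Vp], this lets any condition on all the V_p be tested on one normalised
    lift in one chart. Another lift differs by a scalar function, another chart by a transition map;
    Leibniz and the chain rule absorb both. *)
Lemma is_Vp_sub phi p V q c : smooth A phi -> lift_at q phi c p ->
  is_Vp A phi p V -> forall v, V v -> exists (a : R) e,
    v = a *: coord_lift q phi c (cfun c p) +
        'D_e (coord_lift q phi c) (cfun c p).
Proof.
move=> sphi h [U [psi [c' [[oU sU psiP] Up Ac' c'p ->]]]] _ [a [w ->]].
have [Ac cp lp] := h; have h' : lift_at q phi c' p by [].
pose F := psi \o cinv c'; pose f := coord_lift q phi c'.
(* The factor between the two lifts, since the normalised one has [zform q] equal to 1. *)
pose g y : R^o := zform q (F y).
set x' := cfun c' p.
have dF : differentiable F x'.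
  by have [+ _] := sU c' Ac' 1%N; apply; exists p.
have df : differentiable f x' := lift_diff sphi h'.
have dg : differentiable g x'.
  apply: (differentiable_comp dF); apply: linear_differentiable.
  exact: zform_continuous.
have nU : \forall y \near x', (cfun c' @` (cdom c' `&` U)) y.
  by apply: open_nbhs_nbhs; split; [exact: chart_image_open|exists p].
have E : \forall y \near x', F y = (g y : R) *: f y.
  apply: filterS2 nU (lift_near sphi h') => y [r [c'r Ur] <-] hy.
  have [lr cr _] := lift_domP Ac' hy; rewrite cfunK // in lr cr.
  have [l1 l0 ll] := liftP lr.
  rewrite /g /F /= cfunK //; have [_ pl] := psiP r Ur.
  move: pl; rewrite (lineP l0 ll) => /vlineP[b ->].
  by rewrite zformZ l1 mulr1.
have FE : F x' = (g x' : R) *: f x' := nbhs_singleton E.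
pose T := cfun c \o cinv c'.
have dT : differentiable T x'.
  have [+ _] := @atlas_compatible _ _ A c' c Ac' Ac 1%N; apply.
  by exists p.
have Tx : T x' = cfun c p by rewrite /T /= cfunK.
have fT : \forall y \near x', f y = (coord_lift q phi c \o T) y.
  have nC : \forall y \near x', (cfun c' @` (cdom c' `&` cdom c)) y.
    apply: open_nbhs_nbhs; split; last by exists p.
    by apply: chart_image_open; exact: cdom_open.
  apply: filterS nC => _ [r [c'r cr] <-].
  by rewrite /f /coord_lift /T /= !cfunK.
have dl : differentiable (coord_lift q phi c) (T x').
  by rewrite Tx; exact: lift_diff.
have Df e : 'D_e f x' = 'D_('d T x' e) (coord_lift q phi c) (cfun c p).
  rewrite (near_eq_derive _ fT) (deriveE _ (differentiable_comp dT dl)).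
  by rewrite diff_comp // -Tx (deriveE _ dl).
have fx : f x' = coord_lift q phi c (cfun c p).
  by rewrite (nbhs_singleton fT) /= Tx.
(* Read off from F = g f and f = [coord_lift q phi c] composed with T: the derivative of g falls on
   the lift itself, and the rest is a derivative along the image of w under dT. *)
exists (a * g x' + 'D_w g x'), ((g x' : R) *: 'd T x' w).
rewrite -(deriveE _ dF) (derive_scale_zform w dg df dF E) Df.
have -> : psi p = F x' by rewrite /F /= cfunK.
rewrite FE fx scalerDl scalerA.
have -> : 'D_((g x' : R) *: 'd T x' w) (coord_lift q phi c) (cfun c p) =
    (g x' : R) *: 'D_('d T x' w) (coord_lift q phi c) (cfun c p).
  by rewrite -Tx !(deriveE _ dl) linearZ.
by rewrite -!addrA; congr (_ + _); rewrite addrC.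
Qed.

End Lifts.

(** * The operations *)

Section RightAnnihilators.
Variable R : realType.
Implicit Types z y t w m : zorn R.

Lemma zmul_comb0r w (u v : R44 R) (a b : R) :
  zmul w (rho u) = 0 -> zmul w (rho v) = 0 ->
  zmul w (rho (a *: u + b *: v)) = 0.
Proof.
by move=> wu wv; rewrite rhoD !rhoZ zmulDr !zmulZr wu wv !scaler0 addr0.
Qed.

Lemma zmul_comb0l m (u v : R44 R) (a b : R) :
  zmul (rho u) m = 0 -> zmul (rho v) m = 0 ->
  zmul (rho (a *: u + b *: v)) m = 0.
Proof.
by move=> um vm; rewrite rhoD !rhoZ zmulDl !zmulZl um vm !scaler0 addr0.
Qed.

(** Conjugation exchanges left and right annihilators, so the right-hand results follow from the
    left-hand ones. *)
Lemma zmul_bar_eq0 z w : zmul (zbar z) (zbar w) = 0 <-> zmul w z = 0.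
Proof. by rewrite -zbarM; split=> [/zbar_eq0|->] //; rewrite zbar0. Qed.

Lemma zann_exists_right z y t : zfree3 z y t ->
  zdot z z = 0 -> zdot y y = 0 -> zdot t t = 0 ->
  zdot z y = 0 -> zdot z t = 0 -> zdot y t = 0 ->
  exists2 m, m <> 0 & [/\ zmul z m = 0, zmul y m = 0 & zmul t m = 0].
Proof.
move=> /zfree3_bar fr zz yy tt zy zt yt.
have [||||||w w0 [wz wy wt]] := zann_exists fr; rewrite ?zdot_bar //.
by exists (zbar w); [move/zbar_eq0|split; apply/zmul_bar_eq0; rewrite zbarK].
Qed.

Lemma zann_unique_right z y t m m' : zfree3 z y t -> m <> 0 ->
  zmul z m = 0 -> zmul y m = 0 -> zmul t m = 0 ->
  zmul z m' = 0 -> zmul y m' = 0 -> zmul t m' = 0 ->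
  exists a : R, m' = a *: m.
Proof.
move=> /zfree3_bar fr m0 zm ym tm zm' ym' tm'.
have [|||||||a e] := @zann_unique _ _ _ _ (zbar m) (zbar m') fr;
  try exact/zmul_bar_eq0; first by move/zbar_eq0.
by exists a; rewrite -(zbarK m') e zbarZ zbarK.
Qed.

End RightAnnihilators.

Section Operations.
Variables (R : realType) (S : topologicalType) (A : smooth_surface R S).
Implicit Types (phi : S -> quadric R) (c : chart R S) (p : S) (z : quadric R).

Lemma is_Vp_forall phi p q c (P : R44 R -> Prop) :
  smooth A phi -> lift_at A q phi c p ->
  (forall V, is_Vp A phi p V -> V `<=` P) <->
  (forall (a : R) e,
     P (a *: coord_lift q phi c (cfun c p) +
        'D_e (coord_lift q phi c) (cfun c p))).
Proof.
move=> sphi h; split=> [PV a e|PV V VV v Vv].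
  by apply: (PV _ (lift_is_Vp sphi h)); exists a, e.
by have [a [e ->]] := is_Vp_sub sphi h VV Vv.
Qed.

(** Z matters only up to scalar, so any nonzero vector of the line can replace it. The geometric
    condition becomes equations between lifts, which can be differentiated. *)
Lemma plus_pointP phi p q c z v : smooth A phi -> lift_at A q phi c p ->
  v != 0 -> v \in line z ->
  plus_point A phi p z <->
  zmul (rho v) (rho (coord_lift q phi c (cfun c p))) = 0 /\
  forall e, zmul (rho v) (rho ('D_e (coord_lift q phi c) (cfun c p))) = 0.
Proof.
move=> sphi h v0 vz; split.
  case=> Z [Zl ZV].
  have [b vb] : exists b : R, rho v = b *: Z.
    have : (@rho R @` [set` line z]) (rho v) by exists v.
    by rewrite Zl => -[b _ <-]; exists b.
  have k (a : R) e : zmul (rho v) (rho (a *: coord_lift q phi c (cfun c p) +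
      'D_e (coord_lift q phi c) (cfun c p))) = 0.
    move: a e.
    apply/(is_Vp_forall (fun u => zmul (rho v) (rho u) = 0) sphi h).
    move=> V VV u Vu.
    rewrite vb zmulZl; suff -> : zmul Z (rho u) = 0 by rewrite scaler0.
    by apply: (ZV V VV); exists u.
  split=> [|e].
    by have := k 1 0; rewrite derive0 addr0 scale1r.
  by have := k 0 e; rewrite scale0r add0r.
case=> k0 k1; exists (rho v); split; first exact: rho_line.
move=> V VV _ [u Vu <-]; rewrite /kerL /=.
have [a [e ->]] := is_Vp_sub sphi h VV Vu.
by rewrite rhoP zmulDr zmulZr k0 k1 scaler0 addr0.
Qed.

Lemma minus_pointP phi p q c z v : smooth A phi -> lift_at A q phi c p ->
  v != 0 -> v \in line z ->
  minus_point A phi p z <->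
  zmul (rho (coord_lift q phi c (cfun c p))) (rho v) = 0 /\
  forall e, zmul (rho ('D_e (coord_lift q phi c) (cfun c p))) (rho v) = 0.
Proof.
move=> sphi h v0 vz; split.
  case=> Z [Zl ZV].
  have [b vb] : exists b : R, rho v = b *: Z.
    have : (@rho R @` [set` line z]) (rho v) by exists v.
    by rewrite Zl => -[b _ <-]; exists b.
  have k (a : R) e : zmul (rho (a *: coord_lift q phi c (cfun c p) +
      'D_e (coord_lift q phi c) (cfun c p))) (rho v) = 0.
    move: a e; apply/(is_Vp_forall (fun u => zmul (rho u) (rho v) = 0) sphi h).
    move=> V VV u Vu.
    rewrite vb zmulZr; suff -> : zmul (rho u) Z = 0 by rewrite scaler0.
    by apply: (ZV V VV); exists u.
  split=> [|e].
    by have := k 1 0; rewrite derive0 addr0 scale1r.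
  by have := k 0 e; rewrite scale0r add0r.
case=> k0 k1; exists (rho v); split; first exact: rho_line.
move=> V VV _ [u Vu <-]; rewrite /kerR /=.
have [a [e ->]] := is_Vp_sub sphi h VV Vu.
by rewrite rhoP zmulDl zmulZl k0 k1 scaler0 addr0.
Qed.

Notation e0 := (delta_mx 0 0 : 'rV[R]_2).
Notation e1 := (delta_mx 0 1 : 'rV[R]_2).

Lemma lift_derive_coord phi q c p e : smooth A phi -> lift_at A q phi c p ->
  'D_e (coord_lift q phi c) (cfun c p) =
  (e 0 0 : R) *: 'D_e0 (coord_lift q phi c) (cfun c p) +
  (e 0 1 : R) *: 'D_e1 (coord_lift q phi c) (cfun c p).
Proof.
move=> sphi h; rewrite !(deriveE _ (lift_diff sphi h)).
rewrite {1}(_ : e = (e 0 0 : R) *: e0 + (e 0 1 : R) *: e1).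
  by rewrite linearD !linearZ.
rewrite {1}(row_sum_delta e) !big_ord_recl big_ord0 addr0.
by congr (_ + _); congr (e 0 _ *: delta_mx 0 _); exact: val_inj.
Qed.

(** Applying [zform q] isolates the coefficient of the lift, because it is 1 there and 0 on the
    derivatives; injectivity of the differential removes the other two. *)
Lemma lift_frame phi q c p : immersion A phi -> lift_at A q phi c p ->
  zfree3 (rho (coord_lift q phi c (cfun c p)))
    (rho ('D_e0 (coord_lift q phi c) (cfun c p)))
    (rho ('D_e1 (coord_lift q phi c) (cfun c p))).
Proof.
move=> [sphi inj] h a b d; have [Ac cp lp] := h.
have df := lift_diff sphi h; have [l1 _ _] := liftP h.
rewrite -!rhoZ -!rhoD => /rho_eq0 E.
have coord0 (u v w : R44 R) : a *: u + b *: v + d *: w = 0 ->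
    zform q u = 1 -> zform q v = 0 -> zform q w = 0 -> a = 0.
  move=> e u1 v0 w0; move: (congr1 (zform q) e).
  rewrite !zformD !zformZ u1 v0 w0.
  by rewrite !mulr0 !addr0 mulr1 /zform rho0 zdot0l.
have a0 : a = 0 by exact: coord0 E l1 (zform_derive_lift sphi _ h)
  (zform_derive_lift sphi _ h).
have : (b *: e0 + d *: e1 : 'rV[R]_2) = 0.
  apply: (inj (zform q) c p Ac cp lp); rewrite linear0.
  move: E; rewrite a0 scale0r add0r !(deriveE _ df) => E.
  by rewrite linearD !linearZ.
move=> /rowP M; have := M 0; have := M 1.
rewrite !mxE /= !mulr0 !mulr1 addr0 add0r => -> ->.
by rewrite a0.
Qed.

(** Polarisation, possible because V_p is closed under addition. *)
Lemma totally_isotropic_zdot phi q c p (a b : R) e f :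
  totally_isotropic A phi -> lift_at A q phi c p ->
  zdot (rho (a *: coord_lift q phi c (cfun c p) +
             'D_e (coord_lift q phi c) (cfun c p)))
       (rho (b *: coord_lift q phi c (cfun c p) +
             'D_f (coord_lift q phi c) (cfun c p))) = 0.
Proof.
move=> [sphi iso] h; set u := a *: _ + _; set v := b *: _ + _.
have N (a' : R) e' : zdot (rho (a' *: coord_lift q phi c (cfun c p) +
    'D_e' (coord_lift q phi c) (cfun c p)))
    (rho (a' *: coord_lift q phi c (cfun c p) +
    'D_e' (coord_lift q phi c) (cfun c p))) = 0.
  apply/isotropic_zdot; apply: (iso p _ (lift_is_Vp sphi h)).
  by exists a', e'.
have uv : u + v = (a + b) *: coord_lift q phi c (cfun c p) +
    'D_(e + f) (coord_lift q phi c) (cfun c p).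
  rewrite !(deriveE _ (lift_diff sphi h)) linearD scalerDl /u /v.
  by rewrite !(deriveE _ (lift_diff sphi h)) addrACA.
have polar (x y : zorn R) : zdot x x = 0 -> zdot y y = 0 ->
    zdot (x + y) (x + y) = 0 -> zdot x y = 0.
  by rewrite !zdotDl !zdotDr (zdotC y) => -> ->; lra.
by apply: polar (N a e) (N b f) _; rewrite -rhoD uv; exact: N.
Qed.

Lemma totally_isotropic_frame phi q c p : totally_isotropic A phi ->
  lift_at A q phi c p ->
  let z := rho (coord_lift q phi c (cfun c p)) in
  let zd e := rho ('D_e (coord_lift q phi c) (cfun c p)) in
  [/\ zdot z z = 0, forall e, zdot z (zd e) = 0 &
      forall e f, zdot (zd e) (zd f) = 0].
Proof.
move=> iso h; have dot0 a b e f := totally_isotropic_zdot a b e f iso h.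
set u := coord_lift q phi c (cfun c p) in dot0 *.
set du := fun e => 'D_e (coord_lift q phi c) (cfun c p).
have zE : 1 *: u + du 0 = u by rewrite /du derive0 addr0 scale1r.
have zdE e : 0 *: u + du e = du e by rewrite scale0r add0r.
have zz : zdot (rho u) (rho u) = 0 by rewrite -zE; exact: dot0.
have zd e : zdot (rho u) (rho (du e)) = 0.
  by rewrite -(zdE e) -{1}zE; exact: dot0.
have dd e f : zdot (rho (du e)) (rho (du f)) = 0.
  by rewrite -(zdE e) -(zdE f); exact: dot0.
exact: And3 zz zd dd.
Qed.

Lemma totally_isotropic_of_frame phi q c p : smooth A phi ->
  lift_at A q phi c p ->
  (forall (a : R) e, zdot (rho (a *: coord_lift q phi c (cfun c p) +
             'D_e (coord_lift q phi c) (cfun c p)))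
       (rho (a *: coord_lift q phi c (cfun c p) +
             'D_e (coord_lift q phi c) (cfun c p))) = 0) ->
  forall V, is_Vp A phi p V -> totally_isotropic_set V.
Proof.
move=> sphi h N V VV v Vv; apply/isotropic_zdot.
by have [a [e ->]] := is_Vp_sub sphi h VV Vv.
Qed.

Lemma chart_exists p : exists2 c, atlas A c & cdom c p.
Proof. exact: atlas_cover. Qed.

Lemma line_eq z z' v w (a : R) : v != 0 -> v \in line z -> w != 0 ->
  w \in line z' -> rho w = a *: rho v -> z' = z.
Proof.
move=> v0 vz w0 wz'; rewrite -rhoZ => /(can_inj (@rhoK R)) e.
apply: line_inj; rewrite (lineP w0 wz'); apply/esym/lineP => //.
by rewrite e memvZ.
Qed.

Lemma plus_point_unique phi p z z' : totally_isotropic_immersion A phi ->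
  plus_point A phi p z -> plus_point A phi p z' -> z' = z.
Proof.
move=> [[sphi _] imm] pz pz'.
have [c Ac cp] := chart_exists p; have [q h] := lift_exists phi Ac cp.
have [v v0 vz] := line_neq0 z; have [w w0 wz'] := line_neq0 z'.
have [vk vd] := (plus_pointP sphi h v0 vz).1 pz.
have [wk wd] := (plus_pointP sphi h w0 wz').1 pz'.
have [a] := zann_unique (lift_frame imm h) (rho_neq0 v0) vk (vd _) (vd _)
  wk (wd _) (wd _).
exact: line_eq.
Qed.

Lemma minus_point_unique phi p z z' : totally_isotropic_immersion A phi ->
  minus_point A phi p z -> minus_point A phi p z' -> z' = z.
Proof.
move=> [[sphi _] imm] pz pz'.
have [c Ac cp] := chart_exists p; have [q h] := lift_exists phi Ac cp.
have [v v0 vz] := line_neq0 z; have [w w0 wz'] := line_neq0 z'.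
have [vk vd] := (minus_pointP sphi h v0 vz).1 pz.
have [wk wd] := (minus_pointP sphi h w0 wz').1 pz'.
have [a] := zann_unique_right (lift_frame imm h) (rho_neq0 v0) vk (vd _) (vd _)
  wk (wd _) (wd _).
exact: line_eq.
Qed.

Lemma plus_point_exists phi p : totally_isotropic_immersion A phi ->
  exists z, plus_point A phi p z.
Proof.
move=> [iso imm]; have sphi := iso.1.
have [c Ac cp] := chart_exists p; have [q h] := lift_exists phi Ac cp.
have fr := lift_frame imm h; have [zz zd dd] := totally_isotropic_frame iso h.
have [w w0 [wz wy wt]] :=
  zann_exists fr zz (dd _ _) (dd _ _) (zd _) (zd _) (dd _ _).
have v0 : rhoV w != 0.
  by apply/eqP => e; apply: w0; rewrite -(rhoVK w) e rho0.
have [z lz] : exists z : quadric R, line z = <[rhoV w]>%VS.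
  apply: quadric_line => //; apply/isotropic_zdot; rewrite rhoVK.
  apply: (zdot_orthol wz wz); exact: zfree2_neq0 (zfree3_2 fr).
exists z; apply/(plus_pointP sphi h v0); first by rewrite lz memv_line.
rewrite rhoVK; split=> [|e]; first exact: wz.
by rewrite (lift_derive_coord e sphi h); exact: zmul_comb0r wy wt.
Qed.

Lemma minus_point_exists phi p : totally_isotropic_immersion A phi ->
  exists z, minus_point A phi p z.
Proof.
move=> [iso imm]; have sphi := iso.1.
have [c Ac cp] := chart_exists p; have [q h] := lift_exists phi Ac cp.
have fr := lift_frame imm h; have [zz zd dd] := totally_isotropic_frame iso h.
have [w w0 [wz wy wt]] :=
  zann_exists_right fr zz (dd _ _) (dd _ _) (zd _) (zd _) (dd _ _).
have v0 : rhoV w != 0.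
  by apply/eqP => e; apply: w0; rewrite -(rhoVK w) e rho0.
have [z lz] : exists z : quadric R, line z = <[rhoV w]>%VS.
  apply: quadric_line => //; apply/isotropic_zdot; rewrite rhoVK.
  apply: (zdot_orthor wz wz); exact: zfree2_neq0 (zfree3_2 fr).
exists z; apply/(minus_pointP sphi h v0); first by rewrite lz memv_line.
rewrite rhoVK; split=> [|e]; first exact: wz.
by rewrite (lift_derive_coord e sphi h); exact: zmul_comb0l wy wt.
Qed.

Lemma op_plusP phi p : totally_isotropic_immersion A phi ->
  plus_point A phi p (op_plus A phi p).
Proof. by move=> tii; apply: xgetPex; exact: plus_point_exists. Qed.

Lemma op_minusP phi p : totally_isotropic_immersion A phi ->
  minus_point A phi p (op_minus A phi p).
Proof. by move=> tii; apply: xgetPex; exact: minus_point_exists. Qed.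

(** Existence keeps [xget] from its default value, and uniqueness identifies the point chosen. *)
Lemma op_plus_eq phi f : totally_isotropic_immersion A phi ->
  (forall p, plus_point A phi p (f p)) -> op_plus A phi = f.
Proof.
move=> tii pf; apply/funext => p.
exact: plus_point_unique tii (pf p) (op_plusP p tii).
Qed.

Lemma op_minus_eq phi f : totally_isotropic_immersion A phi ->
  (forall p, minus_point A phi p (f p)) -> op_minus A phi = f.
Proof.
move=> tii pf; apply/funext => p.
exact: minus_point_unique tii (pf p) (op_minusP p tii).
Qed.

End Operations.

(** * Triality *)

Section Triality.
Variables (R : realType) (S : topologicalType) (A : smooth_surface R S).
Variables phi phip phim : S -> quadric R.
Hypotheses (phi_smooth : smooth A phi) (phip_smooth : smooth A phip)
  (phim_smooth : smooth A phim) (phi_immersion : immersion A phi)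
  (phi_plus : forall p, plus_point A phi p (phip p))
  (phi_minus : forall p, minus_point A phi p (phim p)).

Notation e0 := (delta_mx 0 0 : 'rV[R]_2).
Notation e1 := (delta_mx 0 1 : 'rV[R]_2).

Lemma minus_plus_incident p v w : v != 0 -> v \in line (phim p) ->
  w != 0 -> w \in line (phip p) -> zmul (rho v) (rho w) = 0.
Proof.
move=> v0 vm w0 wp.
have [c Ac cp] := chart_exists A p; have [q h] := lift_exists phi Ac cp.
have [wk wd] := (plus_pointP phi_smooth h w0 wp).1 (phi_plus p).
have [vk vd] := (minus_pointP phi_smooth h v0 vm).1 (phi_minus p).
exact: zmul_ann2 (zfree3_2 (lift_frame phi_immersion h)) wk (wd _) vk (vd _).
Qed.

Section AtPoint.
Variables (p : S) (c : chart R S) (q qp qm : zorn R).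
Hypotheses (h : lift_at A q phi c p) (hp : lift_at A qp phip c p)
  (hm : lift_at A qm phim c p).

Let Ac : atlas A c. Proof. by case: h. Qed.
Let x := cfun c p.
Let psi := coord_lift q phi c.
Let omega := coord_lift qp phip c.
Let mu := coord_lift qm phim c.

(** Holding around x, and not only at x, is what allows these relations to be differentiated. *)
Let plus_near : \forall y \near x, zmul (rho (omega y)) (rho (psi y)) = 0 /\
  forall e, zmul (rho (omega y)) (rho ('D_e psi y)) = 0.
Proof.
apply: filterS2 (lift_near phi_smooth h) (lift_near phip_smooth hp) => y.
move=> /(lift_domP Ac)[ly cy _] /(lift_domP Ac)[lpy _ _].
have [_ w0 wl] := liftP lpy; rewrite cy in w0 wl.
by have := (plus_pointP phi_smooth ly w0 wl).1 (phi_plus _); rewrite cy.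
Qed.

Let minus_near : \forall y \near x, zmul (rho (psi y)) (rho (mu y)) = 0 /\
  forall e, zmul (rho ('D_e psi y)) (rho (mu y)) = 0.
Proof.
apply: filterS2 (lift_near phi_smooth h) (lift_near phim_smooth hm) => y.
move=> /(lift_domP Ac)[ly cy _] /(lift_domP Ac)[lmy _ _].
have [_ w0 wl] := liftP lmy; rewrite cy in w0 wl.
by have := (minus_pointP phi_smooth ly w0 wl).1 (phi_minus _); rewrite cy.
Qed.

Let incident_near : \forall y \near x, zmul (rho (mu y)) (rho (omega y)) = 0.
Proof.
apply: filterS2 (lift_near phip_smooth hp) (lift_near phim_smooth hm) => y.
move=> /(lift_domP Ac)[lpy cy _] /(lift_domP Ac)[lmy _ _].
have [_ w0 wl] := liftP lpy; have [_ v0 vl] := liftP lmy.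
by rewrite cy in w0 wl v0 vl; exact: minus_plus_incident v0 vl w0 wl.
Qed.

Let dpsi : differentiable psi x := lift_diff phi_smooth h.
Let domega : differentiable omega x := lift_diff phip_smooth hp.
Let dmu : differentiable mu x := lift_diff phim_smooth hm.
Let ddpsi e : differentiable (fun y => 'D_e psi y) x :=
  lift_diff2 phi_smooth e h.

Lemma derive_plus_psi e : zmul (rho ('D_e omega x)) (rho (psi x)) = 0.
Proof.
have near0 : \forall y \near x, zmul (rho (omega y)) (rho (psi y)) = 0.
  by apply: filterS plus_near => y [].
have := derive_zmul_eq0 e domega dpsi near0.
have [_ k] := nbhs_singleton plus_near.
by rewrite (k e) addr0.
Qed.

Lemma psi_derive_minus e : zmul (rho (psi x)) (rho ('D_e mu x)) = 0.
Proof.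
have near0 : \forall y \near x, zmul (rho (psi y)) (rho (mu y)) = 0.
  by apply: filterS minus_near => y [].
have := derive_zmul_eq0 e dpsi dmu near0.
have [_ k] := nbhs_singleton minus_near.
by rewrite (k e) add0r.
Qed.

(* The only place where the second derivatives of psi enter. *)
Lemma derive_plus_psi_sym d e :
  zmul (rho ('D_d omega x)) (rho ('D_e psi x)) =
  zmul (rho ('D_e omega x)) (rho ('D_d psi x)).
Proof.
have near0 f : \forall y \near x, zmul (rho (omega y)) (rho ('D_f psi y)) = 0.
  by apply: filterS plus_near => y [].
have E1 := derive_zmul_eq0 d domega (ddpsi e) (near0 e).
have E2 := derive_zmul_eq0 e domega (ddpsi d) (near0 d).
have sym : 'D_d (fun y => 'D_e psi y) x = 'D_e (fun y => 'D_d psi y) x.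
  have psiC := @lift_smooth _ _ _ _ q c phi_smooth 2 Ac.
  have domO := @lift_dom_open _ _ _ phi q c phi_smooth.
  exact: (Ck_derive_comm e d domO (lift_dom_at h) psiC).
rewrite sym in E1.
have cancel (X Y Z : zorn R) : X + Z = 0 -> Y + Z = 0 -> X = Y.
  by move=> + YZ; rewrite -YZ => /addIr.
exact: cancel E1 E2.
Qed.

Lemma minus_derive_plus e : zmul (rho (mu x)) (rho ('D_e omega x)) = 0.
Proof.
have [zm dzm] := nbhs_singleton minus_near.
have [_ mu0 _] := liftP hm.
have [h0 h1] := zmul_integrable (lift_frame phi_immersion h) (rho_neq0 mu0)
  (derive_plus_psi e0) (derive_plus_psi e1) zm (dzm e0) (dzm e1)
  (derive_plus_psi_sym e0 e1).
rewrite /omega (lift_derive_coord e phip_smooth hp).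
exact: zmul_comb0r h0 h1.
Qed.

Lemma derive_minus_plus e : zmul (rho ('D_e mu x)) (rho (omega x)) = 0.
Proof.
have := derive_zmul_eq0 e dmu domega incident_near.
by rewrite (minus_derive_plus e) addr0.
Qed.

(** Every such vector annihilates the nonzero element [rho (psi x)] from the left, so [zdot_orthol]
    applies. *)
Lemma plus_isotropic_at (a : R) e :
  zdot (rho (a *: omega x + 'D_e omega x))
    (rho (a *: omega x + 'D_e omega x)) = 0.
Proof.
have [k _] := nbhs_singleton plus_near; have [_ psi0 _] := liftP h.
have E : zmul (rho (a *: omega x + 'D_e omega x)) (rho (psi x)) = 0.
  by have := zmul_comb0l a 1 k (derive_plus_psi e); rewrite scale1r.
exact: (zdot_orthol E E (rho_neq0 psi0)).
Qed.

Lemma minus_isotropic_at (a : R) e :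
  zdot (rho (a *: mu x + 'D_e mu x)) (rho (a *: mu x + 'D_e mu x)) = 0.
Proof.
have [k _] := nbhs_singleton minus_near; have [_ psi0 _] := liftP h.
have E : zmul (rho (psi x)) (rho (a *: mu x + 'D_e mu x)) = 0.
  by have := zmul_comb0r a 1 k (psi_derive_minus e); rewrite scale1r.
exact: (zdot_orthor E E (rho_neq0 psi0)).
Qed.

Lemma minus_point_plus_at : minus_point A phip p (phi p).
Proof.
have [_ psi0 psil] := liftP h; apply/(minus_pointP phip_smooth hp psi0 psil).
by have [k _] := nbhs_singleton plus_near; split=> // e; exact: derive_plus_psi.
Qed.

Lemma plus_point_minus_at : plus_point A phim p (phi p).
Proof.
have [_ psi0 psil] := liftP h; apply/(plus_pointP phim_smooth hm psi0 psil).
have [k _] := nbhs_singleton minus_near.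
by split=> // e; exact: psi_derive_minus.
Qed.

Lemma plus_point_plus_at : plus_point A phip p (phim p).
Proof.
have [_ mu0 mul] := liftP hm; apply/(plus_pointP phip_smooth hp mu0 mul).
by split=> [|e]; [exact: nbhs_singleton incident_near|exact: minus_derive_plus].
Qed.

Lemma minus_point_minus_at : minus_point A phim p (phip p).
Proof.
have [_ om0 oml] := liftP hp; apply/(minus_pointP phim_smooth hm om0 oml).
by split=> [|e]; [exact: nbhs_singleton incident_near|exact: derive_minus_plus].
Qed.

Lemma plus_isotropic_Vp V : is_Vp A phip p V -> totally_isotropic_set V.
Proof.
apply: (totally_isotropic_of_frame phip_smooth hp).
exact: plus_isotropic_at.
Qed.

Lemma minus_isotropic_Vp V : is_Vp A phim p V -> totally_isotropic_set V.
Proof.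
apply: (totally_isotropic_of_frame phim_smooth hm).
exact: minus_isotropic_at.
Qed.

End AtPoint.

(** The chart must be common for the products of lifts to be differentiated; the normalising forms
    may differ. *)
Lemma three_lifts p : exists c q qp qm,
  [/\ lift_at A q phi c p, lift_at A qp phip c p & lift_at A qm phim c p].
Proof.
have [c Ac cp] := chart_exists A p.
have [q h] := lift_exists phi Ac cp; have [qp hp] := lift_exists phip Ac cp.
by have [qm hm] := lift_exists phim Ac cp; exists c, q, qp, qm.
Qed.

Lemma plus_totally_isotropic : totally_isotropic A phip.
Proof.
split=> // p V; have [c [q [qp [qm [h hp _]]]]] := three_lifts p.
exact: plus_isotropic_Vp h hp V.
Qed.

Lemma minus_totally_isotropic : totally_isotropic A phim.
Proof.
split=> // p V; have [c [q [qp [qm [h _ hm]]]]] := three_lifts p.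
exact: minus_isotropic_Vp h hm V.
Qed.

Lemma minus_point_plus p : minus_point A phip p (phi p).
Proof.
have [c [q [qp [qm [h hp _]]]]] := three_lifts p.
exact: minus_point_plus_at h hp.
Qed.

Lemma plus_point_minus p : plus_point A phim p (phi p).
Proof.
have [c [q [qp [qm [h _ hm]]]]] := three_lifts p.
exact: plus_point_minus_at h hm.
Qed.

Lemma plus_point_plus p : plus_point A phip p (phim p).
Proof.
have [c [q [qp [qm [h hp hm]]]]] := three_lifts p.
exact: plus_point_plus_at h hp hm.
Qed.

Lemma minus_point_minus p : minus_point A phim p (phip p).
Proof.
have [c [q [qp [qm [h hp hm]]]]] := three_lifts p.
exact: minus_point_minus_at h hp hm.
Qed.

End Triality.

Lemma cyclic3_action (T : Type) (f g : T -> T) :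
  cancel f g -> (forall x, f (f (f x)) = x) ->
  exists act : {action 'Z_3 &-> T}, forall x,
    act x (1 : 'Z_3) = f x /\ act x (- 1 : 'Z_3) = g x.
Proof.
move=> fg f3.
pose to (x : T) (k : 'Z_3) := iter k f x.
have to0 x : to x 1%g = x by [].
have toM x : act_morph to x.
  move=> i j.
  have it3 m y : iter (m * 3) f y = y.
    by elim: m => // m IH; rewrite mulSn iterD IH; exact: f3.
  have -> : to x (i * j)%g = iter ((i + j) %% 3) f x by [].
  have -> : to (to x i) j = iter (i + j) f x by rewrite addnC iterD.
  by rewrite [in RHS](divn_eq (i + j) 3) iterD it3.
exists (TotalAction to0 toM) => x; split=> //=.
(* In ['Z_3] the element -1 is 2, which acts by f twice; applying f once more gives the identity, so
   f twice is g. *)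
rewrite -(fg (to x _)); congr g.
exact: f3.
Qed.

Theorem mainTheorem3 (R : realType) (S : topologicalType)
    (A : smooth_surface R S) (phi : S -> quadric R) :
  totally_isotropic_immersion A phi ->
  immersion A (op_plus A phi) ->
  immersion A (op_minus A phi) ->
  let E : set (S -> quadric R) := [set phi; op_plus A phi; op_minus A phi] in
  (forall f, E f -> totally_isotropic_immersion A f) /\
  [/\ forall f, E f -> E (op_plus A f),
      forall f, E f -> E (op_minus A f),
      forall f, E f -> op_minus A (op_plus A f) = f /\
                       op_plus A (op_minus A f) = f,
      forall f, E f -> op_plus A (op_plus A (op_plus A f)) = f &
      forall f, E f -> op_minus A (op_minus A (op_minus A f)) = f] /\
  exists act : {action 'Z_3 &-> E}, forall f : E,
    val (act f (1 : 'Z_3)) = op_plus A (val f) /\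
    val (act f (- 1 : 'Z_3)) = op_minus A (val f).
Proof.
move=> tii imm_p imm_m E.
have [[sphi _] imm] := tii; have [[sp _] [sm _]] := (imm_p, imm_m).
have pp p := op_plusP p tii; have mp p := op_minusP p tii.
(* Isotropy has to be established first: [op_plus_eq] and [op_minus_eq] apply only to totally
   isotropic immersions. *)
have tii_p : totally_isotropic_immersion A (op_plus A phi).
  by split=> //; exact: plus_totally_isotropic pp.
have tii_m : totally_isotropic_immersion A (op_minus A phi).
  by split=> //; exact: minus_totally_isotropic mp.
have pm : op_minus A (op_plus A phi) = phi.
  by apply: op_minus_eq => // p; exact: minus_point_plus pp p.
have mpl : op_plus A (op_minus A phi) = phi.
  by apply: op_plus_eq => // p; exact: plus_point_minus mp p.
have ppm : op_plus A (op_plus A phi) = op_minus A phi.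
  by apply: op_plus_eq => // p; exact: plus_point_plus pp mp p.
have mmp : op_minus A (op_minus A phi) = op_plus A phi.
  by apply: op_minus_eq => // p; exact: minus_point_minus pp mp p.
(* The four identities above, with the two images of phi, form the complete table of both operations
   on [E]; the remaining claims are read off from it. *)
have Ep f : E f -> E (op_plus A f).
  by move=> [[->|->]|->]; rewrite ?ppm ?mpl /E /=; tauto.
have Em f : E f -> E (op_minus A f).
  by move=> [[->|->]|->]; rewrite ?mmp ?pm /E /=; tauto.
have Einv f : E f ->
    op_minus A (op_plus A f) = f /\ op_plus A (op_minus A f) = f.
  by move=> [[->|->]|->]; rewrite ?(pm, mpl, ppm, mmp).
have Ep3 f : E f -> op_plus A (op_plus A (op_plus A f)) = f.
  by move=> [[->|->]|->]; rewrite !(pm, mpl, ppm, mmp).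
have Em3 f : E f -> op_minus A (op_minus A (op_minus A f)) = f.
  by move=> [[->|->]|->]; rewrite !(pm, mpl, ppm, mmp).
split; first by move=> f [[->|->]|->].
split; first by split.
pose op (o : (S -> quadric R) -> S -> quadric R) (Eo : forall f, E f -> E (o f))
  (f : E) : E := SigSub (mem_set (Eo _ (set_mem (valP f)))).
have [||act actE] := @cyclic3_action E (op _ Ep) (op _ Em).
- by move=> f; apply: val_inj; have [] := Einv _ (set_mem (valP f)).
- by move=> f; apply: val_inj; exact: Ep3 (set_mem (valP f)).
by exists act => f; have [-> ->] := actE f.
Qed.
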